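(* Let $\mathcal{S}=\{\sigma_0,\dots,\sigma_{N-1}\}$, $N\ge 2$, be an arbitrary iterated function system (possibly with essential overlap) on a complete and separable metric space $(Y,d)$, with attractor set $X$ and Hutchinson measure $\mu$, let $\mathcal{H}=L^2(X,\mu)$, and let $S(X)$ be the collection of all positive operator-valued measures with respect to the pair $(X,L^2(X,\mu))$, equipped with the generalized Kantorovich metric $\rho$. For $0\le i\le N-1$ let $F_i:L^2(X,\mu)\to L^2(X,\mu)$ be given by $F_i\phi=\frac{1}{\sqrt{N}}(\phi\circ\sigma_i)$, and let $S_i=F_i^*$. Then the map $V:S(X)\to S(X)$ given by $$B(\cdot)\mapsto\sum_{i=0}^{N-1}S_i\,B(\sigma_i^{-1}(\cdot))\,S_i^*$$ is a Lipschitz contraction in the $\rho$ metric.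
   Context: A Lipschitz contraction on a metric space $(Z,d_Z)$ is a map $L:Z\to Z$ for which there is $r$ with $0<r<1$ and $d_Z(L(x),L(y))\le r\,d_Z(x,y)$ for all $x,y\in Z$. An iterated function system (IFS) on $Y$ is a finite family $\{\sigma_0,\dots,\sigma_{N-1}\}$, $N\ge 2$, of Lipschitz contractions on $Y$. Its attractor set is the unique nonempty compact $X\subseteq Y$ with $X=\bigcup_{i=0}^{N-1}\sigma_i(X)$; each $\sigma_i$ restricts to a map $X\to X$. Its Hutchinson measure is the unique Borel probability measure $\mu$ on $Y$ that integrates all real-valued Lipschitz functions on $Y$ and satisfies $\mu(\cdot)=\frac1N\sum_{i=0}^{N-1}\mu(\sigma_i^{-1}(\cdot))$; its support is $X$. Essential overlap means $\mu(\sigma_i(X)\cap\sigma_j(X))>0$ for some $i\ne j$; no assumption on overlap is made. The operators $F_i$ are bounded and satisfy $\sum_{i=0}^{N-1}F_i^*F_i=\mathrm{id}_{\mathcal{H}}$, i.e. $\sum_{i=0}^{N-1}S_iS_i^*=\mathrm{id}_{\mathcal{H}}$. $\mathscr{B}(X)$ denotes the Borel subsets of $X$ and $\mathcal{B}(\mathcal{H})$ the bounded operators on $\mathcal{H}$. An operator $L\in\mathcal{B}(\mathcal{H})$ is positive if $\langle Lh,h\rangle\ge 0$ for all $h\in\mathcal{H}$. A positive operator-valued measure (POVM) with respect to the pair $(X,\mathcal{H})$ is a map $A:\mathscr{B}(X)\to\mathcal{B}(\mathcal{H})$ such that: $A(\Delta)$ is a positive operator for all $\Delta\in\mathscr{B}(X)$;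 $A(\emptyset)=0$ and $A(X)=\mathrm{id}_{\mathcal{H}}$; and for every sequence $\{\Delta_n\}_{n=1}^\infty$ of pairwise disjoint sets in $\mathscr{B}(X)$ and all $g,h\in\mathcal{H}$, $\langle A(\bigcup_{n=1}^\infty\Delta_n)g,h\rangle=\sum_{n=1}^\infty\langle A(\Delta_n)g,h\rangle$. For $g,h\in\mathcal{H}$, $A_{g,h}(\Delta)=\langle A(\Delta)g,h\rangle$, and for a bounded Borel function $f$ on $X$, $\int f\,dA\in\mathcal{B}(\mathcal{H})$ is the unique bounded operator with $\langle(\int f\,dA)g,h\rangle=\int_X f\,dA_{g,h}$ for all $g,h\in\mathcal{H}$. Let $\mathrm{Lip}_1(X)=\{f:X\to\mathbb{R} : |f(x)-f(y)|\le d(x,y)\text{ for all }x,y\in X\}$. The generalized Kantorovich metric on $S(X)$ is $\rho(A,B)=\sup_{f\in\mathrm{Lip}_1(X)}\|\int f\,dA-\int f\,dB\|$, where $\|\cdot\|$ is the operator norm. *)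

(* Defs.v *)
From HB Require Import structures.
From mathcomp Require Import all_boot all_order all_algebra.
From mathcomp Require Import complex.
From mathcomp Require Import all_classical all_reals all_analysis measurable_realfun.
From mathcomp Require Import ring lra.

Set Implicit Arguments.
Unset Strict Implicit.
Unset Printing Implicit Defensive.

Import Order.TTheory GRing.Theory Num.Theory.
Import numFieldNormedType.Exports.

Local Open Scope classical_set_scope.
Local Open Scope ring_scope.
Local Open Scope complex_scope.
Local Open Scope quotient_scope.

Section SquareIntegrable.
Context d (T : measurableType d) (R : realType).
Variables (mu : {measure set T -> \bar R}) (D : set T).

Definition sqmodulus (z : R[i]) : R := complex.Re z ^+ 2 + complex.Im z ^+ 2.

Definition square_integrable (f : T -> R[i]) : Prop :=
  [/\ measurable_fun D (fun x => complex.Re (f x)),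
      measurable_fun D (fun x => complex.Im (f x)) &
      mu.-integrable D (fun x => (sqmodulus (f x))%:E)].

Definition cintegral (f : T -> R[i]) : R[i] :=
  (\int[mu]_(x in D) complex.Re (f x)) +i* (\int[mu]_(x in D) complex.Im (f x)).

Definition null_on (f : T -> R[i]) : Prop :=
  f = cst 0 %[ae mu in D].

Lemma ReD (z w : R[i]) : complex.Re (z + w) = complex.Re z + complex.Re w.
Proof. by case: z w => [? ?] [? ?]. Qed.

Lemma ImD (z w : R[i]) : complex.Im (z + w) = complex.Im z + complex.Im w.
Proof. by case: z w => [? ?] [? ?]. Qed.

Lemma ReM (z w : R[i]) : complex.Re (z * w) =
  complex.Re z * complex.Re w - complex.Im z * complex.Im w.
Proof. by case: z w => [? ?] [? ?]. Qed.

Lemma ImM (z w : R[i]) : complex.Im (z * w) =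
  complex.Re z * complex.Im w + complex.Im z * complex.Re w.
Proof. by case: z w => [? ?] [? ?]. Qed.

Lemma ReJ (z : R[i]) : complex.Re (Num.conj z) = complex.Re z.
Proof. by case: z. Qed.

Lemma ImJ (z : R[i]) : complex.Im (Num.conj z) = - complex.Im z.
Proof. by case: z. Qed.

Lemma sqmodulus_ge0 z : 0 <= sqmodulus z.
Proof. by rewrite addr_ge0 ?sqr_ge0. Qed.

Lemma sqmodulus_le (a z w : R[i]) :
  sqmodulus (a * z + w) <= 2 * sqmodulus a * sqmodulus z + 2 * sqmodulus w.
Proof.
case: a z w => [a a'] [z z'] [w w']; rewrite /sqmodulus /= -subr_ge0.
set p := a * z - a' * z'; set q := a * z' + a' * z.
suff -> : 2 * (a ^+ 2 + a' ^+ 2) * (z ^+ 2 + z' ^+ 2) + 2 * (w ^+ 2 + w' ^+ 2)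
   - ((p + w) ^+ 2 + (q + w') ^+ 2) = (p - w) ^+ 2 + (q - w') ^+ 2.
  by rewrite addr_ge0 ?sqr_ge0.
by rewrite /p /q; ring.
Qed.

Lemma mulC_le (z w : R[i]) :
  `|complex.Re (z * Num.conj w)| <= sqmodulus z + sqmodulus w /\
  `|complex.Im (z * Num.conj w)| <= sqmodulus z + sqmodulus w.
Proof.
have h (x y : R) : `|x * y| <= 2^-1 * (x ^+ 2 + y ^+ 2).
  rewrite ler_norml; apply/andP; split; rewrite -subr_ge0.
    rewrite (_ : _ - _ = 2^-1 * (x + y) ^+ 2); first by rewrite mulr_ge0 ?sqr_ge0.
    by field.
  rewrite (_ : _ - _ = 2^-1 * (x - y) ^+ 2); first by rewrite mulr_ge0 ?sqr_ge0.
  by field.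
have hh (x y x' y' : R) :
    `|x * y + x' * y'| <= 2^-1 * (x ^+ 2 + y ^+ 2) + 2^-1 * (x' ^+ 2 + y' ^+ 2).
  by rewrite (le_trans (ler_normD _ _))// lerD.
case: z w => [z z'] [w w']; rewrite /sqmodulus /=; split.
  rewrite mulrN opprK (le_trans (hh _ _ _ _)) // -subr_ge0.
  have := sqr_ge0 z; have := sqr_ge0 z'; have := sqr_ge0 w; have := sqr_ge0 w'.
  by lra.
rewrite (le_trans (hh _ _ _ _)) // sqrrN.
have := sqr_ge0 z; have := sqr_ge0 z'; have := sqr_ge0 w; have := sqr_ge0 w'.
by lra.
Qed.

Hypothesis mD : measurable D.

Lemma square_integrable0 : square_integrable (fun=> 0).
Proof.
split; [exact: measurable_cst|exact: measurable_cst|].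
rewrite (_ : (fun _ => _) = cst 0%E); first exact: integrable0.
by apply/funext => x; rewrite /sqmodulus /= expr0n /= addr0.
Qed.

Lemma square_integrableP (a : R[i]) f g :
  square_integrable f -> square_integrable g ->
  square_integrable (fun x => a * f x + g x).
Proof.
move=> [rf jf sf] [rg jg sg].
have mr : measurable_fun D (fun x => complex.Re (a * f x + g x)).
  under eq_fun do rewrite ReD ReM.
  apply: measurable_funD => //; apply: measurable_funB;
    by apply: measurable_funM => //; exact: measurable_cst.
have mj : measurable_fun D (fun x => complex.Im (a * f x + g x)).
  under eq_fun do rewrite ImD ImM.
  apply: measurable_funD => //; apply: measurable_funD;
    by apply: measurable_funM => //; exact: measurable_cst.
split => //.
have ih : mu.-integrable D (fun x =>
    ((2 * sqmodulus a)%:E * (sqmodulus (f x))%:E + 2%:E * (sqmodulus (g x))%:E)%E).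
  by apply: integrableD => //; exact: integrableZl.
apply: le_integrable ih => //.
  apply/measurable_EFinP; rewrite /sqmodulus.
  by apply: measurable_funD; exact: measurable_funX.
move=> x Dx; rewrite -!EFinM -EFinD !abse_EFin lee_fin.
rewrite ger0_norm ?sqmodulus_ge0 // ger0_norm ?sqmodulus_le //.
by rewrite addr_ge0 // !mulr_ge0 // sqmodulus_ge0.
Qed.

Lemma square_integrable_mul f g : square_integrable f -> square_integrable g ->
  mu.-integrable D (fun x => (complex.Re (f x * Num.conj (g x)))%:E) /\
  mu.-integrable D (fun x => (complex.Im (f x * Num.conj (g x)))%:E).
Proof.
move=> [rf jf sf] [rg jg sg].
have ih : mu.-integrable D (fun x =>
    ((sqmodulus (f x))%:E + (sqmodulus (g x))%:E)%E) by exact: integrableD.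
split; apply: le_integrable ih => //.
- apply/measurable_EFinP; under eq_fun do rewrite ReM ReJ ImJ.
  apply: measurable_funB; apply: measurable_funM => //.
  exact: measurable_funN.
- move=> x Dx; rewrite -EFinD !abse_EFin lee_fin.
  rewrite [leRHS]ger0_norm; last by apply: addr_ge0; exact: sqmodulus_ge0.
  by have [] := mulC_le (f x) (g x).
- apply/measurable_EFinP; under eq_fun do rewrite ImM ReJ ImJ.
  apply: measurable_funD; apply: measurable_funM => //.
  exact: measurable_funN.
- move=> x Dx; rewrite -EFinD !abse_EFin lee_fin.
  rewrite [leRHS]ger0_norm; last by apply: addr_ge0; exact: sqmodulus_ge0.
  by have [] := mulC_le (f x) (g x).
Qed.

End SquareIntegrable.

Section L2.
Context d (T : measurableType d) (R : realType).
Variables (mu : {measure set T -> \bar R}) (D : set T) (mD : measurable D).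

Definition L2pred & measurable D : {pred T -> R[i]} :=
  mem [set f | square_integrable mu D f].

Record L2fun := MkL2fun { L2fun_val :> T -> R[i] ; _ : L2fun_val \in L2pred mD }.
HB.instance Definition _ := [isSub for L2fun_val].
HB.instance Definition _ := [Choice of L2fun by <:].

Lemma L2funP (f : L2fun) : square_integrable mu D f.
Proof. by case: f => f /=; rewrite inE. Qed.

Fact L2pred_submod : submod_closed (L2pred mD).
Proof.
split; first by rewrite inE; exact: square_integrable0.
move=> a f g; rewrite !inE => sf sg.
exact: (@square_integrableP _ _ _ _ _ mD a f g sf sg).
Qed.
HB.instance Definition _ := GRing.isSubmodClosed.Build _ _ (L2pred mD) L2pred_submod.
HB.instance Definition _ := [SubChoice_isSubLmodule of L2fun by <:].

Definition L2null : {pred L2fun} := mem [set f : L2fun | null_on mu D f].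

Fact L2null_submod : submod_closed L2null.
Proof.
split; first by rewrite inE; apply: aeW => x _.
move=> a f g; rewrite !inE => nf ng.
apply: filterS2 nf ng => x fx gx Dx.
by rewrite /= [LHS](_ : _ = a * f x + g x) // fx // gx // mulr0 addr0.
Qed.
HB.instance Definition _ := GRing.isSubmodClosed.Build _ _ L2null L2null_submod.

(* Complex L^2(D, mu): square-integrable functions on D modulo mu-a.e. equality
   on D. A representative is a function on all of T; only its restriction to D
   is relevant. *)
Definition L2 : Type := Quotient.quot L2null.
HB.instance Definition _ := GRing.Zmodule.on L2.
HB.instance Definition _ := EqQuotient.on L2.

Definition L2repr (u : L2) : L2fun := repr u.
Definition L2pi (f : L2fun) : L2 := \pi_(L2) f.

Lemma L2reprK u : L2pi (L2repr u) = u. Proof. exact: reprK. Qed.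

Lemma L2piP (f g : L2fun) : L2pi f = L2pi g <-> f = g %[ae mu in D].
Proof.
have -> : (L2pi f = L2pi g) <-> (f - g \in L2null).
  by rewrite Quotient.idealrBE; exact: (rwP eqP).
rewrite inE; split; apply: filterS => x fg Dx.
  by apply/eqP; rewrite -subr_eq0; apply/eqP; exact: fg.
by rewrite /= [LHS](_ : _ = f x - g x) // fg // subrr.
Qed.

Lemma L2repr_pi (f : L2fun) : L2repr (L2pi f) = f %[ae mu in D].
Proof. by apply/L2piP; rewrite L2reprK. Qed.

Lemma L2piD f g : L2pi (f + g) = L2pi f + L2pi g.
Proof. by rewrite /L2pi !piE. Qed.

Definition L2scale (a : R[i]) (u : L2) : L2 := L2pi (a *: L2repr u).

Lemma L2piZ a f : L2pi (a *: f) = L2scale a (L2pi f).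
Proof.
apply/L2piP; apply: filterS (L2repr_pi f) => x fx Dx.
by rewrite [LHS](_ : _ = a * f x) // [RHS](_ : _ = a * L2repr (L2pi f) x) // fx.
Qed.

Fact L2scaleA a b u : L2scale a (L2scale b u) = L2scale (a * b) u.
Proof. by rewrite -[u]L2reprK -!L2piZ scalerA. Qed.
Fact L2scale1 : left_id 1 L2scale.
Proof. by move=> u; rewrite -[u]L2reprK -!L2piZ scale1r. Qed.
Fact L2scaleDr : right_distributive L2scale +%R.
Proof.
by move=> a u v; rewrite -[u]L2reprK -[v]L2reprK -L2piD -!L2piZ -L2piD scalerDr.
Qed.
Fact L2scaleDl u : {morph L2scale^~ u : a b / a + b}.
Proof. by move=> a b; rewrite -[u]L2reprK -!L2piZ -L2piD scalerDl. Qed.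
HB.instance Definition _ := GRing.Zmodule_isLmodule.Build R[i] L2
  L2scaleA L2scale1 L2scaleDr L2scaleDl.

Lemma L2piP_lin a f g : L2pi (a *: f + g) = a *: L2pi f + L2pi g.
Proof. by rewrite L2piD L2piZ. Qed.

(* The class in L^2(D, mu) of a square-integrable function, 0 otherwise. *)
Definition L2class (f : T -> R[i]) : L2 := L2pi (insubd 0 f).

Definition L2dot (u v : L2) : R[i] :=
  cintegral mu D (fun x => L2repr u x * Num.conj (L2repr v x)).

Let idot (f g : L2fun) := cintegral mu D (fun x => f x * Num.conj (g x)).

Lemma L2dotE (f g : L2fun) : L2dot (L2pi f) (L2pi g) = idot f g.
Proof.
have [rf jf] := square_integrable_mul mD (L2funP f) (L2funP g).
have [rg jg] := square_integrable_mul mD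
  (L2funP (L2repr (L2pi f))) (L2funP (L2repr (L2pi g))).
congr (_ +i* _); congr fine; apply: ae_eq_integral => //;
  try (by apply: measurable_int; eassumption);
  apply: filterS2 (L2repr_pi f) (L2repr_pi g) => x fx gx Dx;
  by rewrite fx // gx.
Qed.

Let idotJ f g : idot f g = Num.conj (idot g f).
Proof.
rewrite /idot /cintegral /=; congr (_ +i* _).
  by congr fine; apply: eq_integral => x _; rewrite !ReM !ReJ !ImJ; congr EFin; ring.
have [_ h] := square_integrable_mul mD (L2funP g) (L2funP f).
rewrite -mulN1r -RintegralZl //; congr fine; apply: eq_integral => x _.
by rewrite !ImM !ReJ !ImJ; congr EFin; ring.
Qed.

Let idotP a f g h : idot (a *: f + g) h = a * idot f h + idot g h.
Proof.
have [rf jf] := square_integrable_mul mD (L2funP f) (L2funP h).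
have [rg jg] := square_integrable_mul mD (L2funP g) (L2funP h).
have zi b (k : T -> R) : mu.-integrable D (EFin \o k) ->
  mu.-integrable D (EFin \o (fun x => b * k x)).
  by move=> ki; exact: (@integrableZl _ _ _ mu D mD b (EFin \o k) ki).
case: a => a a'; rewrite /idot /cintegral /=; congr (_ +i* _).
  rewrite -!RintegralZl // -RintegralB //; try exact: zi.
  rewrite -RintegralD //; last first.
    exact: (integrableB mD (zi a _ rf) (zi a' _ jf)).
  congr fine; apply: eq_integral => x _; congr EFin.
  rewrite [(_ + _) x](_ : _ = (a +i* a') * f x + g x) // !(ReM, ImM, ReD, ImD, ReJ, ImJ) /=.
  by ring.
rewrite -!RintegralZl // -RintegralD //; try exact: zi.
rewrite -RintegralD //; last first.
  exact: (integrableD mD (zi a _ jf) (zi a' _ rf)).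
congr fine; apply: eq_integral => x _; congr EFin.
rewrite [(_ + _) x](_ : _ = (a +i* a') * f x + g x) // !(ReM, ImM, ReD, ImD, ReJ, ImJ) /=.
by ring.
Qed.

Fact L2dotJ u v : L2dot u v = (-1) ^+ false * Num.conj (L2dot v u).
Proof. by rewrite expr0 mul1r -[u]L2reprK -[v]L2reprK !L2dotE idotJ. Qed.

Let L2dotPl v a u w : L2dot (a *: u + w) v = a * L2dot u v + L2dot w v.
Proof.
by rewrite -[u]L2reprK -[v]L2reprK -[w]L2reprK -L2piP_lin !L2dotE idotP.
Qed.

Fact L2dot_bilinear :
  bilinear_for (GRing.Scale.Law.clone _ _ *%R _)
    (GRing.Scale.Law.clone _ _ (Num.conj \; *%R) _) L2dot.
Proof.
split=> [v a u w|v a u w] /=; first exact: L2dotPl.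
rewrite L2dotJ expr0 mul1r L2dotPl rmorphD rmorphM /=.
by congr (_ * _ + _); rewrite [RHS]L2dotJ expr0 mul1r.
Qed.
HB.instance Definition _ := @bilinear_isBilinear.Build R[i] L2 L2 R[i]
  _ _ L2dot L2dot_bilinear.
HB.instance Definition _ :=
  @isHermitianSesquilinear.Build R[i] L2 false Num.conj L2dot L2dotJ.

Fact L2dot_gt0 u : u != 0 -> 0 < L2dot u u.
Proof.
rewrite -[u]L2reprK L2dotE; set f := L2repr u => f0.
have [_ _ iS] := L2funP f.
have -> : idot f f = (\int[mu]_(x in D) sqmodulus (f x))%:C.
  rewrite /idot /cintegral; congr (_ +i* _).
    congr fine; apply: eq_integral => x _; congr EFin.
    by rewrite ReM ReJ ImJ /sqmodulus; ring.
  rewrite (_ : (fun x => _) = cst 0) ?Rintegral_cst ?mul0r //.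
  by apply/funext => x /=; rewrite ImM ReJ ImJ; ring.
rewrite ltcR lt_neqAle Rintegral_ge0 ?andbT; last by move=> x _; exact: sqmodulus_ge0.
apply: contra f0 => /eqP fE; apply/eqP.
have -> : 0 = L2pi 0 by rewrite /L2pi piE.
apply/L2piP.
have h : (\int[mu]_(x in D) `|(sqmodulus (f x))%:E| = 0)%E.
  under eq_integral do rewrite gee0_abs ?lee_fin ?sqmodulus_ge0 //.
  by rewrite -[LHS]fineK ?integrable_fin_num // -[fine _]fE.
move/ae_eq_integral_abs : h => /(_ mD (measurable_int _ iS)).
apply: filterS => x /[apply] /= -[] /eqP.
rewrite /sqmodulus paddr_eq0 ?sqr_ge0 // !sqrf_eq0 => /andP[/eqP r0 /eqP i0].
by apply/eqP; rewrite eq_complex /= r0 i0 !eqxx.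
Qed.
HB.instance Definition _ := @isDotProduct.Build R[i] L2 L2dot L2dot_gt0.

End L2.

Section Operators.
Context (R : realType) (H : lmodType R[i]) (ip : {dot H for Num.conj}).

Definition hnorm (h : H) : R := Num.sqrt (complex.Re (ip h h)).

Definition bounded_op (A : H -> H) : Prop :=
  linear A /\ exists M : R, forall h, hnorm (A h) <= M * hnorm h.

Definition positive_op (A : H -> H) : Prop := forall h, 0 <= ip (A h) h.

Definition opnorm (A : H -> H) : R :=
  sup [set hnorm (A h) | h in [set h | hnorm h <= 1]].

(* xget yields the zero map if no such operator exists; for a bounded operator
   on a Hilbert space it always does and is unique. The same convention is used
   in op_integral. *)
Definition adjoint (A : H -> H) : H -> H :=
  xget 0 [set B | bounded_op B /\ forall g h, ip (A g) h = ip g (B h)].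

End Operators.

Section ChargeIntegral.
Context d (T : measurableType d) (R : realType).
Variables (nu : {charge set T -> \bar R}).

Let hahnP := cid (Hahn_decomposition nu).
Let hahnN := cid (projT2 hahnP).

Definition charge_integral (D : set T) (f : T -> R) : R :=
  \int[jordan_pos (projT2 hahnN)]_(x in D) f x -
  \int[jordan_neg (projT2 hahnN)]_(x in D) f x.

End ChargeIntegral.

Section POVM.
Context d (T : measurableType d) (R : realType) (D : set T).
Context (H : lmodType R[i]) (ip : {dot H for Num.conj}).

(* POVM with respect to (D, H). D is a measurable subset of T (closed, in the
   application), so its Borel sets are the measurable E with E `<=` D; the
   values of povm_fun elsewhere are irrelevant. *)
Record povm := Povm {
  povm_fun :> set T -> H -> H ;
  povm_bounded : forall E, measurable E -> E `<=` D -> bounded_op ip (povm_fun E) ;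
  povm_positive : forall E, measurable E -> E `<=` D -> positive_op ip (povm_fun E) ;
  povm_set0 : povm_fun set0 = 0 ;
  povm_full : povm_fun D = idfun ;
  povm_sigma_additive : forall F : (set T)^nat,
    (forall n, measurable (F n) /\ F n `<=` D) -> trivIset setT F ->
    forall g h : H,
      (series (fun n => ip (povm_fun (F n) g) h) : (R[i]^o)^nat) @ \oo -->
      (ip (povm_fun (\bigcup_n F n) g) h : R[i]^o) }.

Variables (mD : measurable D) (A : povm) (g h : H).

(* Real and imaginary parts of the complex measure A_{g,h}, extended by 0
   outside D. *)
Definition povm_re & measurable D : set T -> \bar R :=
  fun E => (complex.Re (ip (A (E `&` D) g) h))%:E.
Definition povm_im & measurable D : set T -> \bar R :=
  fun E => (complex.Im (ip (A (E `&` D) g) h))%:E.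

Let cvg_parts (u : (R[i]^o)^nat) (l : R[i]^o) : series u @ \oo --> l ->
  series (fun n => complex.Re (u n)) @ \oo --> complex.Re l /\
  series (fun n => complex.Im (u n)) @ \oo --> complex.Im l.
Proof.
have sRe n : series (fun n => complex.Re (u n)) n = complex.Re (series u n).
  rewrite /series /=; elim: n => [|n IH]; first by rewrite !big_geq.
  by rewrite !big_nat_recr //= IH ReD.
have sIm n : series (fun n => complex.Im (u n)) n = complex.Im (series u n).
  rewrite /series /=; elim: n => [|n IH]; first by rewrite !big_geq.
  by rewrite !big_nat_recr //= IH ImD.
move=> /cvgrPdist_lt ul; split; apply/cvgrPdist_lt => e e0;
  (have /ul : 0 < e%:C by rewrite ltcR); apply: filterS => n;
  rewrite ?sRe ?sIm normc_def ltcR; apply: le_lt_trans; rewrite -sqrtr_sqr ler_wsqrtr //;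
  case: l {ul} => a b; case: (series u n) => a' b' /=; rewrite ?lerDl ?lerDr ?sqr_ge0 //.
Qed.

Let povm_parts F : (forall i, measurable (F i)) -> trivIset setT F ->
  (fun n => (\sum_(0 <= i < n) povm_re mD (F i))%E) @ \oo -->
    povm_re mD (\bigcup_n F n) /\
  (fun n => (\sum_(0 <= i < n) povm_im mD (F i))%E) @ \oo -->
    povm_im mD (\bigcup_n F n).
Proof.
move=> mF tF.
have mFD n : measurable (F n `&` D) /\ F n `&` D `<=` D.
  by split; [exact: measurableI|exact: subIsetr].
have tFD : trivIset setT (fun n => F n `&` D).
  apply/trivIsetP => i j _ _ ij.
  by move/trivIsetP : tF => /(_ i j I I ij); rewrite setIACA => ->; rewrite set0I.
have [hr hi] := cvg_parts (@povm_sigma_additive A _ mFD tFD g h).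
rewrite /povm_re /povm_im setI_bigcupl; split.
- under eq_fun do rewrite sumEFin; apply/fine_cvgP; split; first exact: nearW.
  exact: hr.
- under eq_fun do rewrite sumEFin; apply/fine_cvgP; split; first exact: nearW.
  exact: hi.
Qed.

Let povm_re0 : povm_re mD set0 = 0%E.
Proof. by rewrite /povm_re set0I povm_set0 linear0l. Qed.
Let povm_re_fin E : measurable E -> povm_re mD E \is a fin_num.
Proof. by []. Qed.
Let povm_re_sigma : semi_sigma_additive (povm_re mD).
Proof. by move=> F mF tF _; have [] := povm_parts mF tF. Qed.
HB.instance Definition _ := isCharge.Build _ T R (povm_re mD)
  povm_re0 povm_re_fin povm_re_sigma.

Let povm_im0 : povm_im mD set0 = 0%E.
Proof. by rewrite /povm_im set0I povm_set0 linear0l. Qed.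
Let povm_im_fin E : measurable E -> povm_im mD E \is a fin_num.
Proof. by []. Qed.
Let povm_im_sigma : semi_sigma_additive (povm_im mD).
Proof. by move=> F mF tF _; have [] := povm_parts mF tF. Qed.
HB.instance Definition _ := isCharge.Build _ T R (povm_im mD)
  povm_im0 povm_im_fin povm_im_sigma.

(* The integral of f over D against the complex measure A_{g,h}. *)
Definition povm_integral (f : T -> R) : R[i] :=
  charge_integral (povm_re mD) D f +i* charge_integral (povm_im mD) D f.

End POVM.

Section OperatorIntegral.
Context d (T : measurableType d) (R : realType) (D : set T) (mD : measurable D).
Context (H : lmodType R[i]) (ip : {dot H for Num.conj}).

Definition op_integral (A : povm D ip) (f : T -> R) : H -> H :=
  xget 0 [set L | bounded_op ip L /\
                  forall g h, ip (L g) h = povm_integral mD A g h f].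

End OperatorIntegral.

HB.structure Definition CompleteMetric (K : numDomainType) :=
  {T of Complete T & Metric K T}.
Notation completeMetricType := CompleteMetric.type.

Definition separable (Y : topologicalType) : Prop :=
  exists2 Q : set Y, countable Q & dense Q.

Definition lipschitz_contraction (R : realType) (Z : Type) (dist : Z -> Z -> R)
    (L : Z -> Z) : Prop :=
  exists r : R, 0 < r < 1 /\ forall x y, dist (L x) (L y) <= r * dist x y.

Definition borel (Y : ptopologicalType) := g_sigma_algebraType (@open Y).

Section IFS.
Context (R : realType) (Y : completeMetricType R) (N : nat).
Variable sigma : 'I_N -> Y -> Y.

Definition attractor (X : set Y) : Prop :=
  [/\ X !=set0, compact X & X = \bigcup_i (sigma i @` X)].

Lemma attractor_measurable (X : set Y) :
  attractor X -> measurable (X : set (borel Y)).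
Proof.
move=> [_ cX _]; have cl : closed X by exact: compact_closed (@metric_hausdorff R Y) cX.
rewrite -[X]setCK; apply: measurableC; apply: sub_sigma_algebra.
exact: closed_openC.
Qed.

Definition lipschitz_fun (f : Y -> R) : Prop :=
  exists k : R, forall x y, `|f x - f y| <= k * mdist x y.

Definition hutchinson_measure (mu : probability (borel Y) R) : Prop :=
  (forall f : Y -> R, lipschitz_fun f -> mu.-integrable setT (EFin \o f)) /\
  (forall E : set (borel Y), measurable E ->
     mu E = ((N%:R^-1)%:E * \sum_(i < N) mu (sigma i @^-1` E))%E).

End IFS.

Section Kantorovich.
Context (R : realType) (Y : completeMetricType R) (X : set Y).
Context (mX : measurable (X : set (borel Y))).
Context (H : lmodType R[i]) (ip : {dot H for Num.conj}).

Definition Lip1 : set (Y -> R) :=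
  [set f | forall x y, X x -> X y -> `|f x - f y| <= mdist x y].

(* For compact X the operator norms below are bounded, so that this real sup is
   the supremum. *)
Definition kantorovich (A B : povm (X : set (borel Y)) ip) : R :=
  sup [set opnorm ip (op_integral mX A f - op_integral mX B f) | f in Lip1].

End Kantorovich.

(* For an IFS map s, phi \o s is again square integrable on the attractor, by
   invariance of mu, and its class does not depend on the representative. *)
Definition scaled_comp d (T : measurableType d) (R : realType)
    (mu : {measure set T -> \bar R}) (D : set T) (mD : measurable D)
    (N : nat) (s : T -> T) (phi : L2 mu mD) : L2 mu mD :=
  ((Num.sqrt N%:R)^-1)%:C *: L2class mu mD (L2repr phi \o s).

(* Main.v *)
From HB Require Import structures.
Require Import Defs.
From mathcomp Require Import all_boot all_order all_algebra.
From mathcomp Require Import complex.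
From mathcomp Require Import all_classical all_reals all_analysis.
From mathcomp Require Import measurable_realfun ring lra.

Set Implicit Arguments.
Unset Strict Implicit.
Unset Printing Implicit Defensive.

Import Order.TTheory GRing.Theory Num.Theory.
Import numFieldNormedType.Exports.

Local Open Scope classical_set_scope.
Local Open Scope ring_scope.

(** The map V is shown to be a contraction by integrating against V B. Put
   H = L^2(X, mu). The change of variables formula for V reads
     int f d(V B) = sum_i S_i (int (f o sigma_i) dB) F_i
   (op_integral_transport), and if f is 1-Lipschitz on X then f o sigma_i is
   r-Lipschitz on X, where r < 1 is the largest of the contraction ratios.
   Hence the operators D_i = int (f o sigma_i) dA - int (f o sigma_i) dB have
   norm at most r rho(A, B). Since S_i is the adjoint of F_i and
   sum_i |F_i h|^2 = |h|^2, the Cauchy-Schwarz inequality gives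
     |<sum_i S_i D_i F_i h, v>| <= sum_i |D_i F_i h| |F_i v|
                                <= r rho(A, B) |h| |v|
   (hnorm_transport_le), which is the contraction estimate.

   Three things have to be supplied before this argument makes sense.

   Adjoints and operator integrals exist. Both are operators representing a
   bounded sesquilinear form, which the Riesz theorem provides in a complete
   space (riesz_real, bounded_form_op); the completeness of L^2 is L2_complete.

   Integrals against A_(g,h) are sesquilinear in (g, h), monotone, and transform
   as above. All these statements hold by definition for indicators, and they
   pass to bounded measurable functions since a bounded linear functional on
   these functions is nonnegative (or zero) as soon as it is so on indicators
   (bounded_functional_ge0, bounded_functional_eq0). The Hahn
   decompositions of different charges thus never have to be compared.

   The identity sum_i |F_i h|^2 = |h|^2, which also gives (V B)(X) = id, is the
   invariance of mu applied to |h|^2. It requires that mu be carried by X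
   (hutchinson_support): integrating the distance to X, which the maps sigma_i
   decrease by the factor r, shows that this distance vanishes mu-almost
   everywhere. *)

(** * Geometry of a complex space with a dot product *)

Lemma le_geometric_le0 (R : realType) (x C : R) :
  (forall n, x <= C * 2^-1 ^+ n) -> x <= 0.
Proof.
move=> xC; rewrite leNgt; apply/negP => x0.
have C0 : 0 < C by have := xC 0%N; rewrite expr0 mulr1; exact: lt_le_trans.
have [n] : exists n, C / x < n%:R.
  by exists (Num.truncn (C / x)).+1; apply: truncnS_gt.
rewrite ltr_pdivrMr// => Cn.
have := xC n; rewrite exprVn ler_pdivlMr ?exprn_gt0//; apply/negP; rewrite -ltNge.
apply: lt_le_trans Cn _; rewrite mulrC; apply: ler_wpM2l; first exact: ltW.
rewrite -natrX ler_nat.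
by rewrite ltnW// ltn_expl.
Qed.

Section DotSpace.
Context (R : realType) (H : lmodType R[i]) (ip : {dot H for Num.conj}).
Local Open Scope complex_scope.
Implicit Types (g h u v : H) (a : R).
Local Notation nrm := (hnorm ip).

Definition rdot g h : R := complex.Re (ip g h).

Lemma ip_conj g h : ip g h = Num.conj (ip h g).
Proof. by rewrite hermC expr0 mul1r. Qed.

Lemma ipDl g g' h : ip (g + g') h = ip g h + ip g' h.
Proof. exact: linearDl. Qed.

Lemma ipDr g h h' : ip g (h + h') = ip g h + ip g h'.
Proof. exact: linearDr. Qed.

Lemma ipZl c g h : ip (c *: g) h = c * ip g h.
Proof. exact: linearZl_LR. Qed.

Lemma ip0l h : ip 0 h = 0.
Proof. by apply: (addrI (ip 0 h)); rewrite -ipDl !addr0. Qed.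

Lemma ip_suml (I : finType) (G : I -> H) h : ip (\sum_i G i) h = \sum_i ip (G i) h.
Proof. exact: (big_morph (fun g => ip g h) (fun g g' => ipDl g g' h) (ip0l h)). Qed.

Lemma ipZr c g h : ip g (c *: h) = Num.conj c * ip g h.
Proof. by rewrite ip_conj ipZl rmorphM /= -ip_conj. Qed.

Lemma rdotC g h : rdot g h = rdot h g.
Proof. by rewrite /rdot ip_conj Defs.ReJ. Qed.

Lemma rdotDl g g' h : rdot (g + g') h = rdot g h + rdot g' h.
Proof. by rewrite /rdot ipDl Defs.ReD. Qed.

Lemma rdotDr g h h' : rdot g (h + h') = rdot g h + rdot g h'.
Proof. by rewrite rdotC rdotDl !(rdotC g). Qed.

Lemma rdotZl a g h : rdot (a%:C *: g) h = a * rdot g h.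
Proof. by rewrite /rdot ipZl Defs.ReM /= mul0r subr0. Qed.

Lemma rdotZr a g h : rdot g (a%:C *: h) = a * rdot g h.
Proof. by rewrite rdotC rdotZl rdotC. Qed.

Lemma rdot0l h : rdot 0 h = 0.
Proof. by apply: (addrI (rdot 0 h)); rewrite -rdotDl !addr0. Qed.

Lemma rdotNl g h : rdot (- g) h = - rdot g h.
Proof. by apply: (addrI (rdot g h)); rewrite -rdotDl !subrr rdot0l. Qed.

Lemma rdotNr g h : rdot g (- h) = - rdot g h.
Proof. by rewrite rdotC rdotNl rdotC. Qed.

Lemma rdot_suml (I : finType) (f : I -> H) h :
  rdot (\sum_i f i) h = \sum_i rdot (f i) h.
Proof.
exact: (big_morph (rdot^~ h) (fun x y => rdotDl x y h) (rdot0l h)).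
Qed.

Lemma Im_ip g h : complex.Im (ip g h) = rdot g ('i *: h).
Proof.
rewrite /rdot ipZr; case: (ip g h) => x y /=.
by rewrite mul0r sub0r mulN1r opprK.
Qed.

Lemma ipE g h : ip g h = rdot g h +i* rdot g ('i *: h).
Proof. by rewrite -Im_ip /rdot; case: (ip g h). Qed.

Lemma rdot_ge0 h : 0 <= rdot h h.
Proof. by have := dnorm_ge0 ip h; rewrite lecE => /andP[_]. Qed.

Lemma hnorm_sq h : nrm h ^+ 2 = rdot h h.
Proof. by rewrite sqr_sqrtr// rdot_ge0. Qed.

Lemma hnorm_ge0 h : 0 <= nrm h. Proof. exact: sqrtr_ge0. Qed.

Lemma rdot_eq0 h : rdot h h = 0 -> h = 0.
Proof.
move=> h0; apply/eqP; rewrite -(dnorm_eq0 ip) eq_complex /= -/(rdot h h) h0 eqxx.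
by rewrite Im_ip; have := dnorm_ge0 ip h; rewrite lecE Im_ip => /andP[].
Qed.

Lemma hnorm0 : nrm 0 = 0.
Proof. by rewrite /hnorm -/(rdot 0 0) rdot0l sqrtr0. Qed.

Lemma hnorm_eq0 h : nrm h = 0 -> h = 0.
Proof. by move=> h0; apply: rdot_eq0; rewrite -hnorm_sq h0 expr0n. Qed.

Lemma hnorm_opp h : nrm (- h) = nrm h.
Proof. by rewrite /hnorm -!/(rdot _ _) rdotNl rdotNr opprK. Qed.

Lemma hnorm_sub g h : nrm (g - h) = nrm (h - g).
Proof. by rewrite -hnorm_opp opprB. Qed.

Lemma hnormZ a h : nrm (a%:C *: h) = `|a| * nrm h.
Proof.
rewrite /hnorm -!/(rdot _ _) rdotZl rdotZr mulrA -expr2 sqrtrM ?sqr_ge0//.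
by rewrite sqrtr_sqr.
Qed.

Lemma rdot_le g h : rdot g h <= nrm g * nrm h.
Proof.
have [h0|h0] := eqVneq (nrm h) 0.
  by rewrite h0 (hnorm_eq0 h0) rdotC rdot0l mulr0.
have [g0|g0] := eqVneq (nrm g) 0.
  by rewrite g0 (hnorm_eq0 g0) rdot0l mul0r.
have gp : 0 < nrm g by rewrite lt_def g0 hnorm_ge0.
have hp : 0 < nrm h by rewrite lt_def h0 hnorm_ge0.
have := rdot_ge0 ((nrm h)%:C *: g - (nrm g)%:C *: h).
rewrite !(rdotDl, rdotDr, rdotNl, rdotNr, rdotZl, rdotZr) (rdotC h g) -!hnorm_sq.
set x := nrm g; set y := nrm h; set z := rdot g h.
move=> pos; suff : 0 <= (2 * x * y) * (x * y - z).
  by rewrite pmulr_rge0 ?subr_ge0// !mulr_gt0.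
by apply: (le_trans pos); rewrite le_eqVlt; apply/orP; left; apply/eqP; ring.
Qed.

Lemma ler_hnormD g h : nrm (g + h) <= nrm g + nrm h.
Proof.
rewrite -(@ler_pXn2r _ 2)// ?nnegrE ?addr_ge0 ?hnorm_ge0//.
rewrite hnorm_sq rdotDl !rdotDr (rdotC h g) sqrrD -!hnorm_sq.
by have := rdot_le g h; lra.
Qed.

Lemma parallelogram g h :
  rdot (g + h) (g + h) + rdot (g - h) (g - h) = 2 * (rdot g g + rdot h h).
Proof. rewrite !(rdotDl, rdotDr, rdotNl, rdotNr) (rdotC h g); ring. Qed.

Lemma rdot_inj g h : (forall k, rdot g k = rdot h k) -> g = h.
Proof.
move=> gh; apply/eqP; rewrite -subr_eq0; apply/eqP/rdot_eq0.
by rewrite rdotDl rdotNl gh subrr.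
Qed.

Lemma ip_inj g h : (forall k, ip g k = ip h k) -> g = h.
Proof. by move=> gh; apply: rdot_inj => k; rewrite /rdot gh. Qed.

(** Only sequences with steps bounded by 2^-n are tested; every Cauchy sequence
   has such a subsequence, and the rate of convergence becomes explicit. *)
Definition complete_dot : Prop :=
  forall u : nat -> H, (forall n, nrm (u n.+1 - u n) <= 2^-1 ^+ n) ->
  exists l, forall n, nrm (u n - l) <= 2 * 2^-1 ^+ n.

(** The representing vector minimizes J h = |h|^2 - 2 l h. By the parallelogram
   law a minimizing sequence is Cauchy, and comparing its values with those of J
   along the lines u n + t h gives, in the limit k, that
   2 t (<k, h> - l h) + t^2 |h|^2 >= 0 for all t. *)
Lemma riesz_real (l : H -> R) (M : R) : complete_dot ->
  (forall g h, l (g + h) = l g + l h) ->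
  (forall a h, l (a%:C *: h) = a * l h) ->
  (forall h, l h <= M * nrm h) ->
  exists k, forall h, l h = rdot k h.
Proof.
move=> cH lD lZ lM.
pose J h := rdot h h - 2 * l h.
have Jge h : - M ^+ 2 <= J h.
  rewrite /J -hnorm_sq; have := lM h; have := sqr_ge0 (nrm h - M).
  by rewrite sqrrB; nra.
pose A := [set J h | h in setT].
have Alb : has_lbound A by exists (- M ^+ 2) => _ [h _ <-].
have Ainf : has_inf A by split => //; exists (J 0), 0.
set m := inf A.
have mJ h : m <= J h by apply: ge_inf => //; exists h.
(* The parallelogram law bounds |u n.+1 - u n|^2 by twice the sum of the errors
   at n and n.+1; with the error 4^-n / 4 at n, this stays below 4^-n. *)
have approx n : exists h, J h <= m + (2^-1 ^+ n) ^+ 2 / 4.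
  have e0 : 0 < (2^-1 ^+ n) ^+ 2 / 4 :> R by rewrite divr_gt0 ?exprn_gt0.
  by have [_ [h _ <-] /ltW] := inf_adherent e0 Ainf; exists h.
have [u uJ] := choice approx.
have uC n : nrm (u n.+1 - u n) <= 2^-1 ^+ n.
  rewrite -(@ler_pXn2r _ 2)// ?nnegrE ?exprn_ge0 ?hnorm_ge0// hnorm_sq.
  have := mJ ((2^-1)%:C *: (u n.+1 + u n)).
  have := parallelogram (u n.+1) (u n).
  rewrite /J lZ lD rdotZl rdotZr => pl.
  have := uJ n; have := uJ n.+1; rewrite /J (exprS _ n) exprMn.
  have := sqr_ge0 (2^-1 ^+ n : R).
  move: (2^-1 ^+ n : R) pl => q pl.
  by lra.
have [k kl] := cH _ uC; exists k => h.
have key t : 0 <= 2 * t * (rdot k h - l h) + t ^+ 2 * nrm h ^+ 2.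
  rewrite -oppr_le0; apply: (@le_geometric_le0 _ _ (4^-1 + 4 * `|t| * nrm h)) => n.
  have := mJ (u n + t%:C *: h).
  rewrite /J !(rdotDl, rdotDr, rdotZl, rdotZr) lD lZ (rdotC h).
  have := uJ n; rewrite /J hnorm_sq => un ut.
  have c1 : t * (rdot (u n) h - rdot k h) <= `|t| * (2 * 2^-1 ^+ n * nrm h).
    have d1 v : rdot v h <= nrm v * nrm h by exact: rdot_le.
    have -> : rdot (u n) h - rdot k h = rdot (u n - k) h by rewrite rdotDl rdotNl.
    apply: (le_trans (ler_norm _)); rewrite normrM ler_wpM2l// ler_norml.
    rewrite lerNl -rdotNl; apply/andP; split; apply: (le_trans (d1 _));
      by rewrite ?hnorm_opp ler_wpM2r ?hnorm_ge0.
  have q1 : (2^-1 ^+ n) ^+ 2 <= 2^-1 ^+ n :> R.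
    by rewrite expr2 ler_piMl ?exprn_ge0// exprn_ile1//; lra.
  move: (2^-1 ^+ n : R) un c1 q1 => q un c1 q1.
  by lra.
apply/eqP; rewrite eq_sym -subr_eq0; apply/eqP.
move: (rdot k h - l h) key => d key.
set s := nrm h ^+ 2 in key; have s0 : 0 <= s by exact: sqr_ge0.
(* The minimizer t = - d / s of the quadratic polynomial is undefined for s = 0;
   replacing s by s + 1 avoids the case distinction. *)
have := key (- d / (s + 1)).
have sp : 0 < s + 1 by lra.
have -> : 2 * (- d / (s + 1)) * d + (- d / (s + 1)) ^+ 2 * s =
  - (d ^+ 2 * ((s + 2) / (s + 1) ^+ 2)).
  by field; lra.
rewrite oppr_ge0 pmulr_lle0 ?divr_gt0 ?exprn_gt0//; last lra.
by move=> d0; apply/eqP; rewrite -sqrf_eq0 eq_le d0 sqr_ge0.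
Qed.

(** The vector that represents the real functional Re b(g, .) represents all of
   b(g, .): an imaginary part is the real part at the argument multiplied by i.
   This is also why a bound on the real part suffices. *)
Lemma bounded_form_op (b : H -> H -> R[i]) (M : R) : complete_dot ->
  (forall h, scalar (b^~ h)) ->
  (forall g h h', b g (h + h') = b g h + b g h') ->
  (forall g c h, b g (c *: h) = Num.conj c * b g h) ->
  (forall g h, complex.Re (b g h) <= M * nrm g * nrm h) ->
  exists L, [/\ bounded_op ip L, forall g h, ip (L g) h = b g h &
    forall h, nrm (L h) <= M * nrm h].
Proof.
move=> cH bl bDr bZr bM.
have ex g : exists k, forall h, complex.Re (b g h) = rdot k h.
  apply: (@riesz_real _ (M * nrm g)) => //.
    by move=> h h'; rewrite bDr Defs.ReD.
  by move=> a h; rewrite bZr Defs.ReM /= oppr0 mul0r subr0.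
have [L Lb] := choice ex.
have LE g h : ip (L g) h = b g h.
  rewrite ipE -!Lb bZr; case: (b g h) => x y /=.
  by rewrite mul0r sub0r mulN1r opprK.
have LM h : nrm (L h) <= M * nrm h.
  have [->|h0] := eqVneq (nrm (L h)) 0.
    have [->|h0] := eqVneq (nrm h) 0; first by rewrite mulr0.
    have hp : 0 < nrm h by rewrite lt_def h0 hnorm_ge0.
    have := bM h h; have := bM h (- h).
    rewrite -scaleN1r bZr rmorphN1 mulN1r scaleN1r hnorm_opp.
    have -> : complex.Re (- b h h) = - complex.Re (b h h) by case: (b h h).
    by rewrite -(pmulr_lge0 _ hp); lra.
  have hp : 0 < nrm (L h) by rewrite lt_def h0 hnorm_ge0.
  by rewrite -(ler_pM2r hp) -expr2 hnorm_sq -Lb.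
exists L; split=> //; split; last by exists M.
move=> c g g'; apply: ip_inj => k.
by rewrite ipDl ipZl !LE bl.
Qed.

Lemma adjoint_unique (A B : H -> H) : bounded_op ip B ->
  (forall g h, ip (A g) h = ip g (B h)) -> adjoint ip A = B.
Proof.
move=> bB AB; rewrite /adjoint; apply: xget_unique => // C [_ AC].
apply/funext => h; apply: ip_inj => k.
by rewrite ip_conj -AC [RHS]ip_conj -AB.
Qed.

(** The adjoint is the operator of the form (h, g) |-> <h, A g>. *)
Lemma adjointP (A : H -> H) : complete_dot -> bounded_op ip A ->
  bounded_op ip (adjoint ip A) /\ forall g h, ip (A g) h = ip g (adjoint ip A h).
Proof.
move=> cH [lA [M AM]].
have [ | | | |B [bB BE _]] := @bounded_form_op (fun h g => ip h (A g)) (Num.max M 0) cH.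
- by move=> h c g g'; rewrite ipDl ipZl.
- by move=> g h h'; rewrite -[h]scale1r lA scale1r !ipDr scale1r.
- by move=> g c h; rewrite (scalable_linear lA) /= ipZr.
- move=> g h; apply: (le_trans (rdot_le _ _)); rewrite -mulrA mulrCA.
  by rewrite ler_wpM2l ?hnorm_ge0// (le_trans (AM h))// ler_wpM2r ?hnorm_ge0// le_max lexx.
have AB g h : ip (A g) h = ip g (B h) by rewrite ip_conj -BE -ip_conj.
by rewrite (adjoint_unique bB AB).
Qed.

End DotSpace.

(** * Completeness of the space L2 *)

Lemma limn_einf_le (R : realType) (u : (\bar R)^nat) (B : \bar R) :
  (forall n, u n <= B)%E -> (limn_einf u <= B)%E.
Proof.
move=> uB; rewrite limn_einf_lim; apply: lime_le; first exact: is_cvg_einfs.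
by apply: nearW => n; apply: le_trans (uB n); apply: ereal_inf_lbound; exists n => /=.
Qed.

(** The inequality |t| <= 2^-k + 2^k t^2 bounds the sum of the increments by a
   geometric series plus the sum of their weighted squares. *)
Lemma cvg_of_summable_diff (R : realType) (a q : R^nat) :
  (forall k, (a k.+1 - a k) ^+ 2 <= q k) ->
  (\sum_(0 <= k <oo) (2 ^+ k * q k)%:E < +oo)%E -> cvgn a.
Proof.
move=> aq sq.
have q0 k : 0 <= 2 ^+ k * q k.
  by rewrite mulr_ge0 ?exprn_ge0//; apply: le_trans (aq k); exact: sqr_ge0.
have cq : cvgn (series (fun k => 2 ^+ k * q k)).
  apply: nondecreasing_is_cvgn; first exact: nondecreasing_series.
  have sfin : (\sum_(0 <= k <oo) (2 ^+ k * q k)%:E)%E \is a fin_num.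
    by rewrite ge0_fin_numE//; apply: nneseries_ge0 => k _ _; rewrite lee_fin.
  exists (fine (\sum_(0 <= k <oo) (2 ^+ k * q k)%:E)%E) => _ [n _ <-].
  rewrite -lee_fin fineK// /series /= -sumEFin.
  by apply: (@nneseries_lim_ge _ (fun k => (2 ^+ k * q k)%:E)) => k _ _; rewrite lee_fin.
have cg : cvgn (series (geometric 1 (2^-1 : R))).
  by apply: is_cvg_geometric_series; rewrite ger0_norm//; lra.
have cv : cvgn (series (fun k => geometric 1 (2^-1 : R) k + 2 ^+ k * q k)).
  rewrite (_ : series _ = series (geometric 1 (2^-1 : R)) \+
    series (fun k => 2 ^+ k * q k)); first exact: is_cvgD.
  by apply/funext => n; rewrite /series /= big_split.
have ct : cvgn (series (telescope a)).
  apply: (@normed_cvg R R^o); apply: (@series_le_cvg _ _ _ _ _ _ cv) => k //=.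
    by rewrite addr_ge0// mul1r exprn_ge0.
  rewrite mul1r exprVn; have := aq k; have := q0 k.
  set p : R := 2 ^+ k; have p0 : 0 < p by exact: exprn_gt0.
  rewrite /telescope /=; set t := a k.+1 - a k => qp tq.
  rewrite -(ler_pM2l p0) mulrDr mulfV ?gt_eqF//.
  have h1 : p * (p * t ^+ 2) <= p * (p * q k) by rewrite !ler_pM2l.
  apply: le_trans (lerD (lexx 1) h1).
  have : p * `|t| <= 1 + (p * `|t|) ^+ 2.
    by have := sqr_ge0 (p * `|t| - 1); nra.
  by rewrite exprMn real_normK ?num_real// expr2 mulrA.
have -> : a = (fun n => a 0%N + series (telescope a) n).
  by apply/funext => n; exact: eq_sum_telescope.
by apply: is_cvgD => //; exact: is_cvg_cst.
Qed.

Section L2complete.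
Context d (T : measurableType d) (R : realType).
Variables (mu : {measure set T -> \bar R}) (D : set T) (mD : measurable D).
Local Open Scope complex_scope.
Local Notation ip := (@L2dot _ _ R mu D mD).

Lemma ReB (z w : R[i]) : complex.Re (z - w) = complex.Re z - complex.Re w.
Proof. by case: z w => [? ?] [? ?]. Qed.

Lemma ImB (z w : R[i]) : complex.Im (z - w) = complex.Im z - complex.Im w.
Proof. by case: z w => [? ?] [? ?]. Qed.

Lemma cintegral_sqmodulus (f : T -> R[i]) :
  complex.Re (cintegral mu D (fun x => f x * Num.conj (f x))) =
  \int[mu]_(x in D) sqmodulus (f x).
Proof.
rewrite /cintegral /=; congr fine; apply: eq_integral => x _; congr EFin.
by rewrite Defs.ReM Defs.ReJ Defs.ImJ /sqmodulus; ring.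
Qed.

Lemma measurable_sqmodulus (f : T -> R[i]) :
  measurable_fun D (fun x => complex.Re (f x)) ->
  measurable_fun D (fun x => complex.Im (f x)) ->
  measurable_fun D (fun x => sqmodulus (f x)).
Proof. by move=> rf jf; apply: measurable_funD; exact: measurable_funX. Qed.

Lemma measurable_Esqmodulus (f : T -> R[i]) :
  measurable_fun D (fun x => complex.Re (f x)) ->
  measurable_fun D (fun x => complex.Im (f x)) ->
  measurable_fun D (fun x => (sqmodulus (f x))%:E).
Proof. by move=> rf jf; apply/measurable_EFinP; exact: measurable_sqmodulus. Qed.

Lemma hnorm_L2pi (f : L2fun mu mD) :
  ((hnorm ip (L2pi f) ^+ 2)%:E = \int[mu]_(x in D) (sqmodulus (f x))%:E)%E.
Proof.
rewrite hnorm_sq /rdot [X in complex.Re X](L2dotE f f) cintegral_sqmodulus /Rintegral fineK//.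
by have [_ _ h] := L2funP f; exact: integrable_fin_num.
Qed.

Lemma L2piB (f g : L2fun mu mD) : L2pi (f - g) = L2pi f - L2pi g.
Proof. by rewrite -scaleN1r addrC L2piP_lin scaleN1r addrC. Qed.

(** If |u n.+1 - u n| <= 2^-n, the series sum_k 2^k |f k.+1 - f k|^2 of the
   representatives has integral at most 2, so it is finite almost everywhere and
   the representatives converge there. Fatou's lemma turns the bounds on
   |u m - u n| into bounds on the distance of u n to the pointwise limit. *)
Lemma L2_complete : complete_dot ip.
Proof.
move=> u uC.
pose f n : L2fun mu mD := L2repr (u n).
have uE n : u n = L2pi (f n) by rewrite L2reprK.
have uB m n : u m - u n = L2pi (f m - f n) by rewrite L2piB -!uE.
have mf n : measurable_fun D (fun x => complex.Re (f n x)) /\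
            measurable_fun D (fun x => complex.Im (f n x)).
  by have [] := L2funP (f n).
have mRB m (g : T -> R[i]) : measurable_fun D (fun x => complex.Re (g x)) ->
    measurable_fun D (fun x => complex.Re (g x - f m x)).
  by move=> mg; under eq_fun do rewrite ReB; exact: measurable_funB (mf m).1.
have mIB m (g : T -> R[i]) : measurable_fun D (fun x => complex.Im (g x)) ->
    measurable_fun D (fun x => complex.Im (g x - f m x)).
  by move=> mg; under eq_fun do rewrite ImB; exact: measurable_funB (mf m).2.
pose sq k x := sqmodulus (f k.+1 x - f k x).
have msq k : measurable_fun D (sq k).
  by apply: measurable_sqmodulus; [apply: mRB|apply: mIB]; have [] := mf k.+1.
have sq0 k x : 0 <= sq k x by exact: sqmodulus_ge0.
have isq k : (\int[mu]_(x in D) (2 ^+ k * sq k x)%:E <= (2^-1 ^+ k)%:E)%E.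
  under eq_integral do rewrite EFinM.
  rewrite ge0_integralZl_EFin//; last first.
  - exact/measurable_EFinP.
  - by move=> x _; rewrite lee_fin.
  rewrite (_ : \int[mu]_(x in D) _ = ((hnorm ip (u k.+1 - u k) ^+ 2)%:E))%E; last first.
    by rewrite uB hnorm_L2pi.
  rewrite -EFinM lee_fin (@le_trans _ _ (2 ^+ k * (2^-1 ^+ k) ^+ 2))//.
    rewrite ler_wpM2l ?exprn_ge0// lerXn2r ?nnegrE ?hnorm_ge0 ?exprn_ge0//.
  by rewrite expr2 mulrA -exprMn divff// expr1n mul1r.
pose W x := (\sum_(0 <= k <oo) (2 ^+ k * sq k x)%:E)%E.
have W0 x : (0 <= W x)%E.
  by apply: nneseries_ge0 => k _ _; rewrite lee_fin mulr_ge0 ?exprn_ge0.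
have mW2 k : measurable_fun D (fun x => (2 ^+ k * sq k x)%:E).
  by apply/measurable_EFinP; apply: measurable_funM => //; exact: measurable_cst.
have Wfin : {ae mu, forall x, D x -> W x \is a fin_num}.
  apply: integrable_ae => //; apply/integrableP; split.
    apply: ge0_emeasurable_sum => //.
    by move=> k x _ _; rewrite lee_fin mulr_ge0 ?exprn_ge0.
  under eq_integral do rewrite gee0_abs//.
  rewrite integral_nneseries//; last first.
    by move=> n x _; rewrite lee_fin mulr_ge0 ?exprn_ge0.
  apply: (@le_lt_trans _ _ (\sum_(0 <= k <oo) (2 / (2 ^ k.+1)%:R)%:E)%E).
    apply: lee_nneseries => k _.
      by move=> _; apply: integral_ge0 => x _; rewrite lee_fin mulr_ge0 ?exprn_ge0.
    apply: le_trans (isq k) _; rewrite lee_fin expnS natrM invfM mulrA divff//.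
    by rewrite mul1r exprVn natrX.
  apply: le_lt_trans (epsilon_trick0 xpredT _) _ => //.
  exact: ltry.
(* The upper limit is measurable on all of D, including the null set where the
   sequence diverges. *)
pose F x : R[i] :=
  fine (limn_esup (fun n => (complex.Re (f n x))%:E)) +i*
  fine (limn_esup (fun n => (complex.Im (f n x))%:E)).
have mF : measurable_fun D (fun x => complex.Re (F x)) /\
          measurable_fun D (fun x => complex.Im (F x)).
  split; apply: measurableT_comp => //; apply: measurable_fun_limn_esup => n;
    by apply/measurable_EFinP; have [] := mf n.
have Fcvg x : W x \is a fin_num ->
    (fun n => complex.Re (f n x)) @ \oo --> complex.Re (F x) /\
    (fun n => complex.Im (f n x)) @ \oo --> complex.Im (F x).
  move=> Wx; have Woo : (W x < +oo)%E by rewrite -ge0_fin_numE.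
  have lim (a : R^nat) : cvgn a -> a @ \oo --> fine (limn_esup (fun n => (a n)%:E)).
    move=> ca; have aE : (fun n => (a n)%:E) @ \oo --> (limn a)%:E.
      by apply: cvg_EFin; [exact: nearW|exact: ca].
    by rewrite (cvg_limn_einf_sup aE).2.
  split; apply: lim; apply: cvg_of_summable_diff Woo => k;
    rewrite /sq /sqmodulus; case: (f k.+1 x) (f k x) => [a b] [a' b'] /=;
    by rewrite ?lerDl ?lerDr ?sqr_ge0.
have un n m : hnorm ip (u (n + m)%N - u n) <= 2 * 2^-1 ^+ n.
  suff : hnorm ip (u (n + m)%N - u n) <= 2 * 2^-1 ^+ n - 2 * 2^-1 ^+ (n + m).
    by move=> h; apply: le_trans h _; rewrite gerBl mulr_ge0 ?exprn_ge0.
  elim: m => [|m IH]; first by rewrite addn0 !subrr hnorm0.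
  rewrite addnS -[u (n + m).+1](subrK (u (n + m)%N)) -addrA.
  apply: le_trans (ler_hnormD _ _ _) _.
  apply: le_trans (lerD (uC _) IH) _.
  by rewrite exprS mulrA divff// mul1r; lra.
have FB n : (\int[mu]_(x in D) (sqmodulus (F x - f n x))%:E <=
             ((2 * 2^-1 ^+ n) ^+ 2)%:E)%E.
  pose v m x := (sqmodulus (f (n + m)%N x - f n x))%:E.
  have mv m : measurable_fun D (v m).
    apply: measurable_Esqmodulus; [apply: mRB|apply: mIB];
    by have [] := mf (n + m)%N.
  rewrite (@ge0_ae_eq_integral _ _ _ mu D _ (fun x => limn_einf (v^~ x)))//.
  - apply: le_trans (fatou _ _ _ _) _ => //.
      by move=> m x _; rewrite lee_fin sqmodulus_ge0.
    apply: limn_einf_le => m.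
    rewrite (_ : \int[mu]_(x in D) _ = (hnorm ip (u (n + m)%N - u n) ^+ 2)%:E)%E.
      by rewrite lee_fin lerXn2r ?nnegrE ?hnorm_ge0 ?mulr_ge0 ?exprn_ge0.
    by rewrite uB hnorm_L2pi.
  - by apply: measurable_Esqmodulus; [apply: mRB|apply: mIB]; have [] := mF.
  - rewrite /limn_einf; apply: measurableT_comp => //.
    by apply: measurable_fun_limn_esup => m; exact: measurableT_comp.
  - by move=> x _; rewrite lee_fin sqmodulus_ge0.
  - move=> x _; rewrite limn_einf_lim; apply: lime_ge; first exact: is_cvg_einfs.
    by apply: nearW => m; apply: le_ereal_inf_tmp => _ [k _ <-]; rewrite lee_fin sqmodulus_ge0.
  - apply: filterS Wfin => x /[apply] /Fcvg[cR cI].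
    apply/esym; apply: (cvg_limn_einf_sup _).1; apply: cvg_EFin.
      exact: nearW.
    rewrite /sqmodulus !ReB !ImB.
    have c2 (a : R^nat) (l b : R) : a @ \oo --> l ->
        (fun m => (a (n + m)%N - b) ^+ 2) @ \oo --> (l - b) ^+ 2.
      move=> al; rewrite expr2; under eq_fun do rewrite expr2.
      suff h : (fun m => a (n + m)%N - b) @ \oo --> l - b by exact: cvgM.
      apply: cvgB; last exact: cvg_cst.
      have -> : (fun m => a (n + m)%N) = [sequence a (k + n)%N]_k.
        by apply/funext => k /=; rewrite addnC.
      by rewrite (cvg_shiftn n).
    rewrite (_ : fine \o _ = (fun m =>
      (complex.Re (f (n + m)%N x) - complex.Re (f n x)) ^+ 2 +
      (complex.Im (f (n + m)%N x) - complex.Im (f n x)) ^+ 2)); last first.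
      by apply/funext => m; rewrite /v /= /sqmodulus ReB ImB.
    exact: cvgD (c2 _ _ _ cR) (c2 _ _ _ cI).
have sFf n : square_integrable mu D (fun x => F x - f n x).
  split; [by apply: mRB; have [] := mF|by apply: mIB; have [] := mF|].
  apply/integrableP; split.
    by apply: measurable_Esqmodulus; [apply: mRB|apply: mIB]; have [] := mF.
  under eq_integral do rewrite gee0_abs ?lee_fin ?sqmodulus_ge0//.
  exact: le_lt_trans (FB n) (ltry _).
have sF : square_integrable mu D F.
  have := square_integrableP mD 1 (sFf 0%N) (L2funP (f 0%N)).
  by under eq_fun do rewrite mul1r subrK.
have sF' : F \in L2pred mu mD by rewrite inE.
exists (L2pi (MkL2fun sF')) => n.
rewrite hnorm_sub uE -L2piB.
rewrite -(@ler_pXn2r _ 2)// ?nnegrE ?hnorm_ge0 ?mulr_ge0 ?exprn_ge0//.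
by rewrite -lee_fin hnorm_L2pi; exact: FB.
Qed.

End L2complete.

(** * Bounded functionals on bounded measurable functions *)

Section BoundedFunctional.
Context d (T : measurableType d) (R : realType).
Variables (D : set T) (mD : measurable D).
Implicit Types (f g : T -> R) (L : (T -> R) -> R).

Definition bounded_measurable f (M : R) : Prop :=
  measurable_fun D f /\ forall x, D x -> `|f x| <= M.

(** Models integration over D against a signed measure of finite variation. *)
Definition bounded_functional L : Prop :=
  (forall a f g M M', bounded_measurable f M -> bounded_measurable g M' ->
     L (fun x => a * f x + g x) = a * L f + L g) /\
  (exists C, forall f M, bounded_measurable f M -> `|L f| <= C * M).

Lemma bounded_measurableP a f g M M' :
  bounded_measurable f M -> bounded_measurable g M' ->
  bounded_measurable (fun x => a * f x + g x) (`|a| * M + M').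
Proof.
move=> [mf fM] [mg gM]; split.
  by apply: measurable_funD => //; apply: measurable_funM.
move=> x Dx; apply: le_trans (ler_normD _ _) _.
by rewrite normrM lerD ?ler_wpM2l ?fM ?gM.
Qed.

Lemma bounded_measurable_cst c : bounded_measurable (cst c) `|c|.
Proof. by split => // x _. Qed.

Lemma bounded_measurable_indic E : measurable E -> bounded_measurable (\1_E) 1.
Proof.
move=> mE; split; first exact: measurable_indic.
by move=> x _; rewrite indicE; case: (_ \in _); rewrite ?normr0 ?normr1.
Qed.

Lemma bounded_functionalD L L' : bounded_functional L -> bounded_functional L' ->
  bounded_functional (fun f => L f + L' f).
Proof.
move=> [lL [C LC]] [lL' [C' LC']]; split.
  by move=> a f g M M' bf bg; rewrite (lL _ _ _ _ _ bf bg) (lL' _ _ _ _ _ bf bg); ring.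
exists (C + C') => f M bf; apply: le_trans (ler_normD _ _) _.
by rewrite mulrDl lerD ?LC ?LC'.
Qed.

Lemma bounded_functionalZ c L : bounded_functional L ->
  bounded_functional (fun f => c * L f).
Proof.
move=> [lL [C LC]]; split.
  by move=> a f g M M' bf bg; rewrite (lL _ _ _ _ _ bf bg); ring.
exists (`|c| * C) => f M bf; rewrite normrM -mulrA ler_wpM2l//; exact: LC.
Qed.

Lemma bounded_functionalN L : bounded_functional L ->
  bounded_functional (fun f => - L f).
Proof.
move=> bL; under [X in bounded_functional X]eq_fun do rewrite -mulN1r.
exact: bounded_functionalZ.
Qed.

Lemma bounded_functionalB L L' : bounded_functional L -> bounded_functional L' ->
  bounded_functional (fun f => L f - L' f).
Proof. by move=> bL bL'; exact/bounded_functionalD/bounded_functionalN. Qed.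

Lemma bounded_functional_sum (I : finType) (L : I -> (T -> R) -> R) :
  (forall i, bounded_functional (L i)) ->
  bounded_functional (fun f => \sum_i L i f).
Proof.
move=> bL; split.
  move=> a f g M M' bf bg; rewrite mulr_sumr -big_split /=.
  by apply: eq_bigr => i _; rewrite ((bL i).1 _ _ _ _ _ bf bg).
have [C LC] := choice (fun i => (bL i).2).
exists (\sum_i C i) => f M bf; apply: le_trans (ler_norm_sum _ _ _) _.
by rewrite mulr_suml ler_sum// => i _; exact: LC.
Qed.

Lemma bounded_functional_comp (tau : T -> T) L : measurable_fun D tau ->
  (forall x, D x -> D (tau x)) -> bounded_functional L ->
  bounded_functional (fun f => L (f \o tau)).
Proof.
move=> mt Dt [lL [C LC]].
have bt f M : bounded_measurable f M -> bounded_measurable (f \o tau) M.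
  move=> [mf fM]; split; last by move=> x Dx; exact/fM/Dt.
  by apply: (measurable_comp mD) mf mt => _ [x Dx <-]; exact: Dt.
split; first by move=> a f g M M' /bt bf /bt bg; exact: lL bf bg.
by exists C => f M /bt; exact: LC.
Qed.

Lemma bounded_functional_vanish L f M : bounded_functional L ->
  bounded_measurable f M -> (forall x, D x -> f x = 0) -> L f = 0.
Proof.
move=> [_ [C LC]] [mf _] f0; apply/eqP; rewrite -normr_le0.
have /LC : bounded_measurable f 0 by split=> // x /f0 ->; rewrite normr0.
by rewrite mulr0.
Qed.

Lemma eq_bounded_functional L f g M : bounded_functional L ->
  bounded_measurable f M -> measurable_fun D g -> (forall x, D x -> f x = g x) ->
  L f = L g.
Proof.
move=> bL bf mg fg.
have bg : bounded_measurable g M.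
  by split => // x Dx; rewrite -fg//; case: bf => _; exact.
have b := bounded_measurableP (-1) bf bg.
apply/eqP; rewrite -subr_eq0 -oppr_eq0 opprB addrC -mulN1r -(bL.1 _ _ _ _ _ bf bg).
by apply/eqP/(bounded_functional_vanish bL b) => x Dx; rewrite fg// mulN1r addNr.
Qed.

(** A function with values in [0, M] becomes one with values in [0, M/2] when
   (M/2) times the indicator of the set where it exceeds M/2 is subtracted;
   iterating bounds the functional from below by a geometric sequence. *)
Lemma bounded_functional_ge0 L : bounded_functional L ->
  (forall E, measurable E -> E `<=` D -> 0 <= L \1_E) ->
  forall f M, bounded_measurable f M -> (forall x, D x -> 0 <= f x) -> 0 <= L f.
Proof.
move=> bL L1 f M bf f0; have [lL [C LC]] := bL.
have claim n : forall g K, bounded_measurable g K -> (forall x, D x -> 0 <= g x) ->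
    - L g <= C * K * 2^-1 ^+ n.
  elim: n => [|n IH] g K bg g0.
    rewrite expr0 mulr1; apply: le_trans (LC _ _ bg).
    by rewrite -normrN ler_norm.
  pose E := D `&` g @^-1` `[K / 2, +oo[.
  have mE : measurable E by apply: bg.1 => //; exact: measurable_itv.
  have b1 := bounded_measurable_indic mE.
  pose g1 x := - (K / 2) * \1_E x + g x.
  have mg1 := (bounded_measurableP (- (K / 2)) b1 bg).1.
  have g1b x : D x -> 0 <= g1 x <= K / 2.
    move=> Dx; rewrite /g1 indicE; have := g0 x Dx; have := bg.2 x Dx.
    case: (boolP (x \in E)) => [|/negP xE].
      rewrite inE => -[_ /=]; rewrite in_itv/= andbT mulr1 => h1 h2 h3.
      by rewrite ger0_norm// in h2; apply/andP; split; lra.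
    rewrite mulr0 add0r => _ ->/=; rewrite leNgt; apply/negP => h; apply: xE.
    by rewrite inE; split => //=; rewrite in_itv/= andbT ltW.
  have bg1 : bounded_measurable g1 (K / 2).
    by split => // x Dx; have /andP[h1 h2] := g1b x Dx; rewrite ger0_norm.
  have LE : L g1 = - (K / 2) * L \1_E + L g by exact: lL b1 bg.
  have h0 x : D x -> 0 <= g1 x by move=> /g1b /andP[].
  have := IH _ _ bg1 h0; rewrite LE => h.
  have K0 : 0 <= K / 2 * L \1_E.
    have L1E := L1 E mE (@subIsetl _ _ _).
    have [->|/set0P[x [Dx _]]] := eqVneq E set0.
      by rewrite indic0 (bounded_functional_vanish bL (bounded_measurable_cst 0))// mulr0.
    have {}K0 := le_trans (normr_ge0 _) (bg.2 x Dx).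
    by rewrite mulr_ge0// divr_ge0.
  have -> : C * K * 2^-1 ^+ n.+1 = C * (K / 2) * 2^-1 ^+ n by rewrite exprS; ring.
  by lra.
by rewrite -oppr_le0; apply: (@le_geometric_le0 _ _ (C * M)) => n; exact: claim.
Qed.

(** This reduces an identity between integrals of bounded functions to the
   identity between the measures of sets. *)
Lemma bounded_functional_eq0 L : bounded_functional L ->
  (forall E, measurable E -> E `<=` D -> L \1_E = 0) ->
  forall f M, bounded_measurable f M -> L f = 0.
Proof.
move=> bL L1 f M bf.
have ge0 g K : bounded_measurable g K -> (forall x, D x -> 0 <= g x) -> L g = 0.
  move=> bg g0; apply/eqP; rewrite eq_le; apply/andP; split; last first.
    by apply: (bounded_functional_ge0 bL _ bg) => // E mE ED; rewrite L1.
  rewrite -oppr_ge0.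
  apply: (bounded_functional_ge0 (bounded_functionalN bL) _ bg) => // E mE ED.
  by rewrite L1// oppr0.
have b1 := bounded_measurable_cst (`|M| : R).
have := bL.1 1 _ _ _ _ bf b1; rewrite (ge0 (cst `|M|) _ b1)// mul1r addr0 => <-.
apply: ge0 (bounded_measurableP 1 bf b1) _ => x Dx.
have := le_trans (bf.2 x Dx) (ler_norm M).
by rewrite ler_norml mul1r => /andP[+ _]; rewrite -subr_ge0 opprK.
Qed.

(** ** Integration against a charge *)

Lemma bounded_functional_Rintegral (m : {finite_measure set T -> \bar R}) :
  bounded_functional (fun f => \int[m]_(x in D) f x).
Proof.
have fin f M : bounded_measurable f M -> m.-integrable D (EFin \o f).
  move=> [mf fM]; apply: measurable_bounded_integrable => //.
    by rewrite ltey_eq fin_num_measure.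
  exists M; split; first exact: num_real.
  by move=> K MK x Dx; exact: le_trans (fM x Dx) (ltW MK).
split.
  move=> a f g M M' bf bg; have fi := fin _ _ bf.
  rewrite -RintegralZl// RintegralD//; last exact: fin bg.
  have b0 := bounded_measurable_cst 0.
  have := bounded_measurableP a bf b0 => /fin.
  by under [X in EFin \o X]eq_fun do rewrite addr0.
exists (fine (m D)) => f M bf; have fi := fin _ _ bf.
apply: le_trans (le_normr_Rintegral _ _) _ => //.
rewrite mulrC -Rintegral_cst//; apply: le_Rintegral => //.
- exact: integrable_norm.
- exact: finite_measure_integrable_cst.
- exact: bf.2.
Qed.

Variable nu : {charge set T -> \bar R}.

Lemma bounded_functional_charge_integral :
  bounded_functional (charge_integral nu D).
Proof. by apply: bounded_functionalB; exact: bounded_functional_Rintegral. Qed.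

Lemma charge_integral_indic E : measurable E ->
  charge_integral nu D \1_E = fine (nu (E `&` D)).
Proof.
move=> mE; rewrite /charge_integral /Rintegral !integral_indic//.
have mED : measurable (E `&` D) by exact: measurableI.
rewrite -fineB ?fin_num_measure//; congr fine.
set h := projT2 (cid (projT2 (cid (Hahn_decomposition nu)))).
by rewrite (jordan_decomp h mED) /cadd /= cscaleN1.
Qed.

End BoundedFunctional.

(** * The operator integral of a bounded function *)

Section ComplexFunctional.
Context d (T : measurableType d) (R : realType).
Variables (D : set T) (mD : measurable D).
Implicit Types (f : T -> R) (L : (T -> R) -> R[i]).
Local Open Scope complex_scope.

(** The real and imaginary parts are kept separate since charges are real. *)
Definition cbounded_functional L : Prop :=
  bounded_functional D (fun f => complex.Re (L f)) /\
  bounded_functional D (fun f => complex.Im (L f)).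

Lemma cbounded_functionalD L L' : cbounded_functional L -> cbounded_functional L' ->
  cbounded_functional (fun f => L f + L' f).
Proof.
move=> [Lr Li] [Lr' Li']; split.
  by under [X in bounded_functional _ X]eq_fun do rewrite Defs.ReD; exact: bounded_functionalD.
by under [X in bounded_functional _ X]eq_fun do rewrite Defs.ImD; exact: bounded_functionalD.
Qed.

Lemma cbounded_functionalZ c L : cbounded_functional L ->
  cbounded_functional (fun f => c * L f).
Proof.
move=> [Lr Li]; split.
  under [X in bounded_functional _ X]eq_fun do rewrite Defs.ReM.
  by apply: bounded_functionalB; exact: bounded_functionalZ.
under [X in bounded_functional _ X]eq_fun do rewrite Defs.ImM.
by apply: bounded_functionalD; exact: bounded_functionalZ.
Qed.

Lemma cbounded_functionalB L L' : cbounded_functional L -> cbounded_functional L' ->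
  cbounded_functional (fun f => L f - L' f).
Proof.
move=> bL bL'; under [X in cbounded_functional X]eq_fun do rewrite -mulN1r.
exact/cbounded_functionalD/cbounded_functionalZ.
Qed.

Lemma cbounded_functional_conj L : cbounded_functional L ->
  cbounded_functional (fun f => Num.conj (L f)).
Proof.
move=> [Lr Li]; split.
  by under [X in bounded_functional _ X]eq_fun do rewrite Defs.ReJ.
by under [X in bounded_functional _ X]eq_fun do rewrite Defs.ImJ;
  exact: bounded_functionalN.
Qed.

Lemma cbounded_functional_sum (I : finType) (L : I -> (T -> R) -> R[i]) :
  (forall i, cbounded_functional (L i)) ->
  cbounded_functional (fun f => \sum_i L i f).
Proof.
move=> bL; split.
  under [X in bounded_functional _ X]eq_fun => f do
    rewrite (big_morph (@complex.Re R) (@Defs.ReD R) (erefl : complex.Re 0 = 0)).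
  by apply: bounded_functional_sum => i; have [] := bL i.
under [X in bounded_functional _ X]eq_fun => f do
  rewrite (big_morph (@complex.Im R) (@Defs.ImD R) (erefl : complex.Im 0 = 0)).
by apply: bounded_functional_sum => i; have [] := bL i.
Qed.

Lemma cbounded_functional_comp (tau : T -> T) L : measurable_fun D tau ->
  (forall x, D x -> D (tau x)) -> cbounded_functional L ->
  cbounded_functional (fun f => L (f \o tau)).
Proof.
move=> mt Dt [Lr Li]; split.
  exact: (@bounded_functional_comp _ _ _ _ mD tau (fun f => complex.Re (L f))).
exact: (@bounded_functional_comp _ _ _ _ mD tau (fun f => complex.Im (L f))).
Qed.

Lemma cbounded_functional_ext L L' : cbounded_functional L -> cbounded_functional L' ->
  (forall E, measurable E -> E `<=` D -> L \1_E = L' \1_E) ->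
  forall f M, bounded_measurable D f M -> L f = L' f.
Proof.
move=> bL bL' LL f M bf; apply/eqP; rewrite -subr_eq0 eq_complex; apply/andP; split.
  apply/eqP/(bounded_functional_eq0 mD (cbounded_functionalB bL bL').1 _ bf).
  by move=> E mE ED; rewrite LL// subrr.
apply/eqP/(bounded_functional_eq0 mD (cbounded_functionalB bL bL').2 _ bf).
by move=> E mE ED; rewrite LL// subrr.
Qed.

Lemma cbounded_functional_linear L a f g M M' : cbounded_functional L ->
  bounded_measurable D f M -> bounded_measurable D g M' ->
  L (fun x => a * f x + g x) = a%:C * L f + L g.
Proof.
move=> [[lr _] [li _]] bf bg; apply/eqP; rewrite eq_complex.
rewrite (lr _ _ _ _ _ bf bg) (li _ _ _ _ _ bf bg) Defs.ReD Defs.ImD Defs.ReM Defs.ImM /=.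
by rewrite !mul0r subr0 addr0 !eqxx.
Qed.

Lemma eq_cbounded_functional L f g M : cbounded_functional L ->
  bounded_measurable D f M -> measurable_fun D g -> (forall x, D x -> f x = g x) ->
  L f = L g.
Proof.
move=> [bR bI] bf mg fg; apply/eqP; rewrite eq_complex; apply/andP; split; apply/eqP.
  exact: (eq_bounded_functional bR bf mg fg).
exact: (eq_bounded_functional bI bf mg fg).
Qed.

End ComplexFunctional.

Section PositiveOp.
Context (R : realType) (H : lmodType R[i]) (ip : {dot H for Num.conj}).
Local Open Scope complex_scope.

(** The form <A v, v> is real at v = g + h and at v = g + i h, which compares the
   imaginary and the real parts of <A g, h> and <A h, g>. *)
Lemma positive_op_sym (A : H -> H) : linear A -> positive_op ip A ->
  forall g h, ip (A g) h = Num.conj (ip (A h) g).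
Proof.
move=> lA pA.
have AD u v : A (u + v) = A u + A v by rewrite -[u]scale1r lA !scale1r.
have AZ c u : A (c *: u) = c *: A u by exact: (scalable_linear lA).
have im0 h : complex.Im (ip (A h) h) = 0.
  by have := pA h; rewrite lecE => /andP[/eqP].
have im g h : complex.Im (ip (A g) h) + complex.Im (ip (A h) g) = 0.
  have := im0 (g + h); rewrite AD !(ipDl, ipDr) !Defs.ImD !im0.
  by rewrite add0r addr0.
move=> g h; apply/eqP; rewrite eq_complex Defs.ReJ Defs.ImJ.
have := im g ('i *: h); rewrite AZ ipZl ipZr Defs.ImM [X in _ + X = _]Defs.ImM /=.
rewrite !mul0r !mul1r !add0r !mulN1r => /eqP.
rewrite addrC subr_eq0 => /eqP ->; rewrite eqxx/= -subr_eq0 opprK.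
by rewrite im.
Qed.

End PositiveOp.

Section OperatorIntegral.
Context d (T : measurableType d) (R : realType) (D : set T) (mD : measurable D).
Context (H : lmodType R[i]) (ip : {dot H for Num.conj}).
Implicit Types (A : povm D ip) (f : T -> R).
Local Open Scope complex_scope.
Local Notation nrm := (hnorm ip).

Lemma povm_linear A E : measurable E -> E `<=` D -> linear (A E).
Proof. by move=> mE ED; have [] := povm_bounded A mE ED. Qed.

Lemma cbounded_functional_povm A g h :
  cbounded_functional D (povm_integral mD A g h).
Proof. by split; exact: bounded_functional_charge_integral. Qed.

Lemma povm_integral_indicI A g h E : measurable E ->
  povm_integral mD A g h \1_E = ip (A (E `&` D) g) h.
Proof.
move=> mE; rewrite /povm_integral !charge_integral_indic//.
by rewrite /= /povm_re /povm_im /= -setIA setIid; case: (ip (A (E `&` D) g) h).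
Qed.

Lemma povm_integral_indic A g h E : measurable E -> E `<=` D ->
  povm_integral mD A g h \1_E = ip (A E g) h.
Proof. by move=> mE ED; rewrite povm_integral_indicI// (setIidl ED). Qed.

Lemma povm_integral_linear A f M h : bounded_measurable D f M ->
  scalar (fun g => povm_integral mD A g h f).
Proof.
move=> bf c g g'.
apply: (@cbounded_functional_ext _ _ _ _ mD (povm_integral mD A (c *: g + g') h)
  (fun f => c * povm_integral mD A g h f + povm_integral mD A g' h f)) bf.
- exact: cbounded_functional_povm.
- apply: cbounded_functionalD; last exact: cbounded_functional_povm.
  by apply: cbounded_functionalZ; exact: cbounded_functional_povm.
- move=> E mE ED; rewrite !povm_integral_indic//.
  by rewrite povm_linear// ipDl ipZl.
Qed.

Lemma povm_integral_conj A f M g h : bounded_measurable D f M ->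
  povm_integral mD A g h f = Num.conj (povm_integral mD A h g f).
Proof.
move=> bf.
apply: (@cbounded_functional_ext _ _ _ _ mD (povm_integral mD A g h)
  (fun f => Num.conj (povm_integral mD A h g f))) bf.
- exact: cbounded_functional_povm.
- by apply: cbounded_functional_conj; exact: cbounded_functional_povm.
- move=> E mE ED; rewrite !povm_integral_indic//; apply: positive_op_sym.
    exact: povm_linear.
  exact: povm_positive.
Qed.

Lemma povm_integralDl A f M g g' h : bounded_measurable D f M ->
  povm_integral mD A (g + g') h f =
  povm_integral mD A g h f + povm_integral mD A g' h f.
Proof.
by move=> bf; rewrite -[g]scale1r (povm_integral_linear A h bf) mul1r scale1r.
Qed.

Lemma povm_integralZl A f M c g h : bounded_measurable D f M ->
  povm_integral mD A (c *: g) h f = c * povm_integral mD A g h f.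
Proof. by move=> bf; exact: (scalable_linear (povm_integral_linear A h bf)). Qed.

Lemma povm_integralDr A f M g h h' : bounded_measurable D f M ->
  povm_integral mD A g (h + h') f =
  povm_integral mD A g h f + povm_integral mD A g h' f.
Proof.
move=> bf; rewrite (povm_integral_conj A _ _ bf) (povm_integralDl A _ _ _ bf).
by rewrite rmorphD /= -!(povm_integral_conj A _ _ bf).
Qed.

Lemma povm_integralZr A f M c g h : bounded_measurable D f M ->
  povm_integral mD A g (c *: h) f = Num.conj c * povm_integral mD A g h f.
Proof.
move=> bf; rewrite (povm_integral_conj A _ _ bf) (povm_integralZl A _ _ _ bf).
by rewrite rmorphM /= -(povm_integral_conj A _ _ bf).
Qed.

Lemma povm_integral_ge0 A f M h : bounded_measurable D f M ->
  (forall x, D x -> 0 <= f x) -> 0 <= complex.Re (povm_integral mD A h h f).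
Proof.
apply: (bounded_functional_ge0 mD (cbounded_functional_povm A h h).1).
move=> E mE ED; rewrite povm_integral_indic//.
by have := povm_positive A mE ED h; rewrite lecE => /andP[].
Qed.

Lemma povm_integral_cst A c g h :
  povm_integral mD A g h (cst c) = c%:C * ip g h.
Proof.
have b0 := bounded_measurable_cst D (0 : R).
have b1 := bounded_measurable_cst D (1 : R).
have bL := cbounded_functional_povm A g h.
have L1 : povm_integral mD A g h (cst 1) = ip g h.
  by rewrite -indicT povm_integral_indicI// setTI povm_full.
have L0 : povm_integral mD A g h (cst 0) = 0.
  apply/eqP; rewrite eq_complex; apply/andP; split; apply/eqP.
    exact: (bounded_functional_vanish bL.1 b0).
  exact: (bounded_functional_vanish bL.2 b0).
have := cbounded_functional_linear c bL b1 b0; rewrite L1 L0 addr0 => <-.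
by congr (povm_integral _ _ _ _ _); apply/funext => x /=; rewrite mulr1 addr0.
Qed.

(** As M - f and M + f are nonnegative, the quadratic form Q of the integral lies
   between - M |v|^2 and M |v|^2. Polarization and the parallelogram law bound
   the real part of the form by M / 2 (|g|^2 + |h|^2), which is M |g| |h| once g
   and h have been rescaled to equal norms. *)
Lemma Re_povm_integral_le A f M g h : bounded_measurable D f M ->
  complex.Re (povm_integral mD A g h f) <= M * nrm g * nrm h.
Proof.
move=> bf.
pose Q v := complex.Re (povm_integral mD A v v f).
have bM := bounded_measurable_cst D M.
have QM v : Q v <= M * rdot ip v v.
  have b := bounded_measurableP (-1) bf bM.
  have := povm_integral_ge0 A v b.
  rewrite (cbounded_functional_linear (-1) (cbounded_functional_povm A v v) bf bM).
  rewrite povm_integral_cst Defs.ReD !Defs.ReM /= !mul0r subr0 mulN1r subr0.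
  rewrite addrC subr_ge0; apply => x Dx.
  by have := bf.2 x Dx; rewrite ler_norml => /andP[_]; lra.
have QN v : - Q v <= M * rdot ip v v.
  have b := bounded_measurableP 1 bf bM.
  have := povm_integral_ge0 A v b.
  rewrite (cbounded_functional_linear 1 (cbounded_functional_povm A v v) bf bM).
  rewrite povm_integral_cst Defs.ReD !Defs.ReM /= !mul0r subr0 mul1r subr0.
  rewrite -lerBlDl sub0r; apply => x Dx.
  by have := bf.2 x Dx; rewrite ler_norml => /andP[+ _]; lra.
have quad u v : complex.Re (povm_integral mD A u v f) <=
    M / 2 * (rdot ip u u + rdot ip v v).
  have := QM (u + v); have := QN (u - v); rewrite /Q -!(scaleN1r v).
  rewrite !(povm_integralDl A _ _ _ bf) !(povm_integralDr A _ _ _ bf).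
  rewrite !(povm_integralZl A _ _ _ bf) !(povm_integralZr A _ _ _ bf) scaleN1r.
  rewrite (povm_integral_conj A v u bf) rmorphN1 !mulN1r opprK.
  rewrite !Defs.ReD.
  have reN z : complex.Re (- z) = - complex.Re z :> R by case: z.
  rewrite !reN Defs.ReJ.
  have := parallelogram ip u v.
  by nra.
(* Zero vectors cannot be rescaled. *)
have [g0|g0] := eqVneq (nrm g) 0.
  rewrite g0 mulr0 mul0r (hnorm_eq0 g0) -(scale0r (0 : H)).
  by rewrite (povm_integralZl A _ _ _ bf) mul0r.
have [h0|h0] := eqVneq (nrm h) 0.
  rewrite h0 mulr0 (hnorm_eq0 h0) -(scale0r (0 : H)).
  by rewrite (povm_integralZr A _ _ _ bf) rmorph0 mul0r.
have gp : 0 < nrm g by rewrite lt_def g0 hnorm_ge0.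
have hp : 0 < nrm h by rewrite lt_def h0 hnorm_ge0.
have := quad ((nrm h)%:C *: g) ((nrm g)%:C *: h).
rewrite (povm_integralZl A _ _ _ bf) (povm_integralZr A _ _ _ bf).
rewrite !(rdotZl, rdotZr) -!hnorm_sq.
set z := povm_integral mD A g h f.
have -> : complex.Re ((nrm h)%:C * (Num.conj (nrm g)%:C * z)) =
  (nrm h * nrm g) * complex.Re z.
  by case: z => x y /=; ring.
move=> hle; rewrite -(ler_pM2l (mulr_gt0 hp gp)); apply: le_trans hle _.
by rewrite le_eqVlt; apply/orP; left; apply/eqP; field.
Qed.

Lemma op_integral_unique A f (L : H -> H) : bounded_op ip L ->
  (forall g h, ip (L g) h = povm_integral mD A g h f) -> op_integral mD A f = L.
Proof.
move=> bL LE; apply: xget_unique => // K [_ KE].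
by apply/funext => g; apply: (@ip_inj _ _ ip) => h; rewrite KE LE.
Qed.

Hypothesis cH : complete_dot ip.

Lemma op_integralP A f M : bounded_measurable D f M ->
  [/\ bounded_op ip (op_integral mD A f),
      forall g h, ip (op_integral mD A f g) h = povm_integral mD A g h f &
      forall h, nrm (op_integral mD A f h) <= M * nrm h].
Proof.
move=> bf.
have [ | | | |L [bL LE LM]] :=
  @bounded_form_op _ _ ip (fun g h => povm_integral mD A g h f) M cH.
- by move=> h; exact: povm_integral_linear bf.
- by move=> g h h'; exact: povm_integralDr bf.
- by move=> g c h; exact: povm_integralZr bf.
- by move=> g h; exact: Re_povm_integral_le.
by rewrite (op_integral_unique bL LE).
Qed.

Lemma op_integral_linear A a f g M M' :
  bounded_measurable D f M -> bounded_measurable D g M' ->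
  op_integral mD A (fun x => a * f x + g x) =
  fun h => a%:C *: op_integral mD A f h + op_integral mD A g h.
Proof.
move=> bf bg; apply/funext => h; apply: (@ip_inj _ _ ip) => k.
have [_ -> _] := op_integralP A (bounded_measurableP a bf bg).
have [_ fE _] := op_integralP A bf; have [_ gE _] := op_integralP A bg.
rewrite ipDl ipZl fE gE.
exact: (cbounded_functional_linear a (cbounded_functional_povm A h k) bf bg).
Qed.

Lemma op_integral_cst A c : op_integral mD A (cst c) = fun h => c%:C *: h.
Proof.
apply/funext => h; apply: (@ip_inj _ _ ip) => k.
have [_ -> _] := op_integralP A (bounded_measurable_cst D c).
by rewrite povm_integral_cst ipZl.
Qed.

End OperatorIntegral.

(** * Transporting an operator-valued measure *)

Section BoundedOps.
Context (R : realType) (H : lmodType R[i]) (ip : {dot H for Num.conj}).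
Implicit Types (A B : H -> H).
Local Notation nrm := (hnorm ip).

Lemma bounded_op_comp A B : bounded_op ip A -> bounded_op ip B -> bounded_op ip (A \o B).
Proof.
move=> [lA [M AM]] [lB [K BK]]; split; first by move=> c g h; rewrite /= lB lA.
exists (`|M| * K) => h /=; apply: le_trans (AM _) _.
apply: le_trans (_ : `|M| * nrm (B h) <= _); first by rewrite ler_wpM2r ?hnorm_ge0 ?ler_norm.
by rewrite -mulrA ler_wpM2l.
Qed.

Lemma bounded_op0 : bounded_op ip 0.
Proof.
split; first by move=> c g h; rewrite scaler0 addr0.
by exists 0 => h; rewrite mul0r hnorm0.
Qed.

Lemma bounded_opD A B : bounded_op ip A -> bounded_op ip B -> bounded_op ip (A + B).
Proof.
move=> [lA [M AM]] [lB [K BK]]; split.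
  by move=> c g h; rewrite !fctE lA lB scalerDr addrACA.
exists (M + K) => h; apply: le_trans (ler_hnormD _ _ _) _.
by rewrite mulrDl lerD.
Qed.

Lemma bounded_op_sum (I : finType) (A : I -> H -> H) :
  (forall i, bounded_op ip (A i)) -> bounded_op ip (\sum_i A i).
Proof.
move=> bA; elim/big_rec : _ => [|i B _ bB]; first exact: bounded_op0.
exact: bounded_opD.
Qed.

End BoundedOps.

Lemma cvg_sum_fin (K : numFieldType) (V : normedModType K) (J : finType)
    (u : J -> V^nat) (l : J -> V) :
  (forall i, u i @ \oo --> l i) -> (fun n => \sum_i u i n) @ \oo --> \sum_i l i.
Proof.
move=> ul; rewrite /index_enum; elim: (Finite.enum _) => [|i s IH].
  by under eq_fun do rewrite big_nil; rewrite big_nil; exact: cvg_cst.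
by under eq_fun do rewrite big_cons; rewrite big_cons; exact: cvgD.
Qed.

Section Transport.
Context d (T : measurableType d) (R : realType) (D : set T) (mD : measurable D).
Context (H : lmodType R[i]) (ip : {dot H for Num.conj}).
Context (J : finType) (F S : J -> H -> H) (tau : J -> T -> T).
Hypothesis mtau : forall i, measurable_fun D (tau i).
Hypothesis Dtau : forall i x, D x -> D (tau i x).
Hypothesis bF : forall i, bounded_op ip (F i).
Hypothesis bS : forall i, bounded_op ip (S i).
Hypothesis FS : forall i g h, ip (F i g) h = ip g (S i h).
Hypothesis sumF : forall g h, \sum_i ip (F i g) (F i h) = ip g h.
Implicit Types (A : povm D ip).
Local Notation nrm := (hnorm ip).

Definition transport_fun A (E : set T) : H -> H :=
  \sum_i (S i \o A (D `&` tau i @^-1` E) \o F i).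

Lemma ip_S i g h : ip (S i g) h = ip g (F i h).
Proof. by rewrite ip_conj -FS -ip_conj. Qed.

Lemma ip_transport A E g h : ip (transport_fun A E g) h =
  \sum_i ip (A (D `&` tau i @^-1` E) (F i g)) (F i h).
Proof.
rewrite /transport_fun fct_sumE ip_suml; apply: eq_bigr => i _ /=.
by rewrite ip_S.
Qed.

Let mE i E : measurable E -> measurable (D `&` tau i @^-1` E).
Proof. by move=> mE; exact: mtau. Qed.

Let transport_bounded A E : measurable E -> E `<=` D -> bounded_op ip (transport_fun A E).
Proof.
move=> mE0 ED; apply: bounded_op_sum => i; apply: bounded_op_comp => //.
by apply: bounded_op_comp => //; apply: povm_bounded; [exact: mE|exact: subIsetl].
Qed.

Let transport_positive A E : measurable E -> E `<=` D -> positive_op ip (transport_fun A E).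
Proof.
move=> mE0 ED h; rewrite ip_transport; apply: sumr_ge0 => i _.
by apply: povm_positive; [exact: mE|exact: subIsetl].
Qed.

Let transport0 A : transport_fun A set0 = 0.
Proof.
apply/funext => g; apply: (@ip_inj _ _ ip) => h; rewrite ip_transport.
rewrite ip0l big1// => i _.
by rewrite preimage_set0 setI0 povm_set0 ip0l.
Qed.

Let transport_full A : transport_fun A D = idfun.
Proof.
apply/funext => g; apply: (@ip_inj _ _ ip) => h; rewrite ip_transport /= -sumF.
apply: eq_bigr => i _; rewrite (setIidl _) ?povm_full// => x Dx.
exact: Dtau.
Qed.

Let transport_sigma A (E : (set T)^nat) :
  (forall n, measurable (E n) /\ E n `<=` D) -> trivIset setT E ->
  forall g h : H,
    (series (fun n => ip (transport_fun A (E n) g) h) : (R[i]^o)^nat) @ \oo -->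
    (ip (transport_fun A (\bigcup_n E n) g) h : R[i]^o).
Proof.
move=> mED tE g h; rewrite ip_transport.
have -> : series (fun n => ip (transport_fun A (E n) g) h) = (fun n => \sum_i
    series (fun n => ip (A (D `&` tau i @^-1` E n) (F i g)) (F i h)) n).
  apply/funext => n; rewrite /series /= exchange_big /=; apply: eq_bigr => k _.
  exact: ip_transport.
have key i : (series (fun n => ip (A (D `&` tau i @^-1` E n) (F i g)) (F i h))
    : (R[i]^o)^nat) @ \oo -->
    (ip (A (D `&` tau i @^-1` (\bigcup_n E n)) (F i g)) (F i h) : R[i]^o).
  rewrite preimage_bigcup setI_bigcupr; apply: povm_sigma_additive.
    by move=> n; split; [apply: mE; have [] := mED n|exact: subIsetl].
  apply/trivIsetP => j k _ _ jk; move/trivIsetP : tE => /(_ j k I I jk) E0.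
  by rewrite setIACA -preimage_setI E0 preimage_set0 setI0.
exact: (@cvg_sum_fin _ (R[i]^o) J _ _ key).
Qed.

Definition transport A : povm D ip :=
  Povm (@transport_bounded A) (@transport_positive A) (transport0 A)
    (transport_full A) (@transport_sigma A).

Hypothesis cH : complete_dot ip.

Lemma bounded_measurable_comp i (f : T -> R) M :
  bounded_measurable D f M -> bounded_measurable D (f \o tau i) M.
Proof.
move=> [mf fM]; split; last by move=> x Dx; exact/fM/Dtau.
by apply: (measurable_comp mD) mf (mtau i) => _ [x Dx <-]; exact: Dtau.
Qed.

(** On indicators this is the definition of the transported measure. *)
Lemma povm_integral_transport A g h f M : bounded_measurable D f M ->
  povm_integral mD (transport A) g h f =
  \sum_i povm_integral mD A (F i g) (F i h) (f \o tau i).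
Proof.
move=> bf.
apply: (@cbounded_functional_ext _ _ _ _ mD (povm_integral mD (transport A) g h)
  (fun f => \sum_i povm_integral mD A (F i g) (F i h) (f \o tau i))) bf.
- exact: cbounded_functional_povm.
- apply: cbounded_functional_sum => i.
  apply: (@cbounded_functional_comp _ _ _ _ mD (tau i)
    (povm_integral mD A (F i g) (F i h))) => //; first exact: Dtau.
  exact: cbounded_functional_povm.
- move=> E mE0 ED; rewrite povm_integral_indic//= ip_transport.
  apply: eq_bigr => i _.
  have mEi := mE i mE0.
  rewrite -(povm_integral_indic mD A _ _ mEi (@subIsetl _ _ _)).
  apply: (eq_cbounded_functional (cbounded_functional_povm mD A (F i g) (F i h))
    (bounded_measurable_indic R D mEi)).
    exact: (bounded_measurable_comp i (bounded_measurable_indic R D mE0)).1.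
  move=> x Dx; rewrite /= !indicE; congr (_%:R); congr nat_of_bool.
  by apply/idP/idP => [/set_mem[_ xE]|/set_mem xE]; apply/mem_set => //; split.
Qed.

Lemma op_integral_transport A f M : bounded_measurable D f M ->
  op_integral mD (transport A) f =
  \sum_i (S i \o op_integral mD A (f \o tau i) \o F i).
Proof.
move=> bf; have bft i := bounded_measurable_comp i bf.
apply: op_integral_unique.
  apply: bounded_op_sum => i; apply: bounded_op_comp => //.
  by apply: bounded_op_comp => //; have [] := op_integralP mD cH A (bft i).
move=> g h; rewrite fct_sumE ip_suml (povm_integral_transport A g h bf).
apply: eq_bigr => i _ /=; rewrite ip_S.
by have [_ -> _] := op_integralP mD cH A (bft i).
Qed.

(** With v the value at h, |v|^2 = sum_i <G_i F_i h, F_i v>, and the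
   Cauchy-Schwarz inequality in the direct sum of copies of H applies because
   (F_i) is an isometry into it. *)
Lemma hnorm_transport_le (G : J -> H -> H) (c : R) h : 0 <= c ->
  (forall i u, nrm (G i u) <= c * nrm u) ->
  nrm ((\sum_i (S i \o G i \o F i)) h) <= c * nrm h.
Proof.
move=> c0 Gc; set v := (\sum_i _) h.
have sF u : \sum_i nrm (F i u) ^+ 2 = nrm u ^+ 2.
  under eq_bigr do rewrite hnorm_sq /rdot.
  by rewrite hnorm_sq /rdot -sumF (big_morph (@complex.Re R) (@Defs.ReD R) (erefl : complex.Re 0 = 0)).
have [->|v0] := eqVneq (nrm v) 0; first by rewrite mulr_ge0 ?hnorm_ge0.
have vp : 0 < nrm v by rewrite lt_def v0 hnorm_ge0.
have vv : nrm v ^+ 2 <= c * \sum_i nrm (F i h) * nrm (F i v).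
  rewrite hnorm_sq {1}/v fct_sumE rdot_suml mulr_sumr ler_sum// => i _ /=.
  rewrite /rdot ip_S -/(rdot _ _ _); apply: le_trans (rdot_le _ _ _) _.
  by rewrite mulrA ler_wpM2r ?hnorm_ge0.
have cs : \sum_i nrm (F i h) * nrm (F i v) <= nrm h * nrm v.
  have [h0|h0] := eqVneq (nrm h) 0.
    rewrite h0 mul0r big1// => i _; apply/eqP; rewrite mulf_eq0; apply/orP; left.
    have [_ [M FM]] := bF i; have := FM h; rewrite h0 mulr0 => Fh.
    by rewrite eq_le Fh hnorm_ge0.
  have hp : 0 < nrm h by rewrite lt_def h0 hnorm_ge0.
  (* Each product is estimated by 2 x y <= x^2 + y^2, weighted so that the two
     sums of squares become equal. *)
  rewrite -(ler_pM2l (mulr_gt0 hp vp)) -(@ler_pM2l _ 2)// mulr_sumr mulr_sumr.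
  apply: (@le_trans _ _ (\sum_i (nrm v ^+ 2 * nrm (F i h) ^+ 2 +
                                 nrm h ^+ 2 * nrm (F i v) ^+ 2))).
    apply: ler_sum => i _.
    by have := sqr_ge0 (nrm v * nrm (F i h) - nrm h * nrm (F i v)); nra.
  by rewrite big_split/= -!mulr_sumr !sF; nra.
rewrite -(ler_pM2r vp) -expr2; apply: le_trans vv _.
by rewrite -mulrA ler_wpM2l.
Qed.

End Transport.

(** * The Hutchinson measure *)

Section MetricBorel.
Context (R : realType) (Y : completeMetricType R).
Local Notation dist := (@mdist R Y).
Implicit Types (f : Y -> R) (D X : set Y).


Lemma measurable_open (U : set Y) : open U -> measurable (U : set (borel Y)).
Proof. exact: sub_sigma_algebra. Qed.

(** The set where f > a is the trace on D of an open set, the union of the balls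
   with center x in D and radius f x - a > 0. *)
Lemma lipschitz1_measurable (D : set (borel Y)) f : measurable D ->
  (forall x y, D x -> D y -> `|f x - f y| <= dist x y) ->
  measurable_fun D (f : borel Y -> R).
Proof.
move=> mD fD _; apply: (measurability _ (RGenOInfty.measurableE R)) => //.
move=> /= _ [_ [a ->] <-].
pose U : set Y := [set y | exists x, [/\ D x, a < f x & dist x y < f x - a]].
rewrite preimage_itvoy (_ : _ `&` _ = D `&` (U : set (borel Y))); last first.
  apply/seteqP; split => y [Dy] /=.
    by move=> ay; split => //; exists y; split; rewrite // mdistxx subr_gt0.
  move=> [x [Dx ax xy]]; split => //.
  by have := fD x y Dx Dy; rewrite ler_norml => /andP[_]; lra.
apply: measurableI => //; apply: measurable_open.
rewrite openE => y [x [Dx ax xy]]; apply/metricType_numDomainType.nbhs_mdistP.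
exists (f x - a - dist x y) => /=; first by rewrite subr_gt0.
move=> z /= yz; exists x; split => //.
by apply: le_lt_trans (metric_triangle x y z) _; rewrite -ltrBrDl.
Qed.

Lemma contraction_measurable (s : Y -> Y) : lipschitz_contraction dist s ->
  measurable_fun setT (s : borel Y -> borel Y).
Proof.
move=> [r [/andP[r0 r1] sr]].
apply: (@measurability _ _ (borel Y) (borel Y) setT s (@open Y)) => //.
move=> /= _ [U oU <-]; rewrite setTI; apply: measurable_open.
rewrite openE => y /= Uy; have : nbhs (s y) U by exact: open_nbhs_nbhs.
move=> /metricType_numDomainType.nbhs_mdistP[e /= e0 eU]; apply/metricType_numDomainType.nbhs_mdistP; exists e => //= z yz.
apply: eU => /=; apply: le_lt_trans (sr y z) _; apply: le_lt_trans yz.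
by rewrite ler_piMl ?mdist_ge0// ltW.
Qed.

Definition dist_to X (y : Y) : R := inf [set dist y x | x in X].

Variable X : set Y.
Hypothesis X0 : X !=set0.

Lemma dist_to_lb y : has_lbound [set dist y x | x in X].
Proof. by exists 0 => _ [x _ <-]; exact: mdist_ge0. Qed.

Lemma dist_to_le y x : X x -> dist_to X y <= dist y x.
Proof. by move=> Xx; apply: (ge_inf (dist_to_lb y)); exists x. Qed.

Lemma le_dist_to y c : (forall x, X x -> c <= dist y x) -> c <= dist_to X y.
Proof.
move=> cX; apply: lb_le_inf; first by have [x Xx] := X0; exists (dist y x), x.
by move=> _ [x Xx <-]; exact: cX.
Qed.

Lemma dist_to_ge0 y : 0 <= dist_to X y.
Proof. by apply: le_dist_to => x _; exact: mdist_ge0. Qed.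

Lemma dist_to_lipschitz y z : `|dist_to X y - dist_to X z| <= dist y z.
Proof.
have half u v : dist_to X u - dist_to X v <= dist u v.
  rewrite lerBlDl -lerBlDr; apply: le_dist_to => x Xx; rewrite lerBlDr.
  by apply: le_trans (dist_to_le u Xx) _; rewrite addrC; exact: metric_triangle.
by rewrite ler_norml half andbT lerNl opprB metric_sym half.
Qed.

Lemma dist_to_eq0 y : closed X -> dist_to X y = 0 -> X y.
Proof.
move=> cX y0; apply: cX => B /metricType_numDomainType.nbhs_mdistP[e /= e0 eB].
have [_ [x Xx <-]] := @inf_adherent _ _ e e0
  (conj (let: ex_intro x Xx := X0 in ex_intro _ (dist y x) (ex_intro2 _ _ x Xx erefl))
    (dist_to_lb y)).
by rewrite -/(dist_to X y) y0 add0r => yx; exists x; split => //; exact: eB.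
Qed.

End MetricBorel.

Section Hutchinson.
Context (R : realType) (Y : completeMetricType R) (N : nat).
Variable sigma : 'I_N -> Y -> Y.
Hypothesis N2 : (2 <= N)%N.
Hypothesis sigma_contr : forall i, lipschitz_contraction (@mdist R Y) (sigma i).
Variables (X : set Y) (X_attr : attractor sigma X).
Variables (mu : probability (borel Y) R) (mu_hutch : hutchinson_measure sigma mu).

Let N0 : (0 < N)%N. Proof. exact: ltn_trans N2. Qed.

Let msigma i := contraction_measurable (sigma_contr i).

Lemma attractor_sub i x : X x -> X (sigma i x).
Proof. by move=> Xx; case: X_attr => _ _ ->; exists i => //; exists x. Qed.

Lemma hutchinson_preimage (E : set (borel Y)) : measurable E ->
  (\sum_(i < N) mu (sigma i @^-1` E) = N%:R%:E * mu E)%E.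
Proof.
move=> mE; rewrite mu_hutch.2// muleA -EFinM divff ?mul1e//.
by rewrite pnatr_eq0 -lt0n.
Qed.

(** The two sides are the integrals of g against the sum of the images of mu and
   against N times mu, which are the same measure. *)
Lemma hutchinson_integral (g : borel Y -> \bar R) : measurable_fun setT g ->
  (forall x, 0 <= g x)%E ->
  (\sum_(i < N) \int[mu]_x g (sigma i x) = N%:R%:E * \int[mu]_x g x)%E.
Proof.
move=> mg g0.
have ex i : {m : {measure set (borel Y) -> \bar R} |
    m = pushforward mu (sigma i : borel Y -> borel Y) :> (set (borel Y) -> \bar R)}.
  by unshelve eexists (pushforward mu (sigma i : borel Y -> borel Y)); [exact: msigma|].
pose m (k : nat) := projT1 (ex (insubd (Ordinal N0) k)).
pose m' (k : nat) : {measure set (borel Y) -> \bar R} := mu.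
have mE (i : 'I_N) :
    m i = pushforward mu (sigma i : borel Y -> borel Y) :> (set (borel Y) -> \bar R).
  by rewrite /m valKd; case: (ex i).
transitivity (\int[msum m N]_x g x)%E.
  rewrite ge0_integral_measure_sum//; apply: eq_bigr => i _.
  by rewrite mE ge0_integral_pushforward.
transitivity (\int[msum m' N]_x g x)%E.
  apply: eq_measure_integral => E mEE _.
  change (\sum_(k < N) m k E = \sum_(k < N) m' k E)%E.
  rewrite (eq_bigr (fun i : 'I_N => mu (sigma i @^-1` E))); last by move=> i _; rewrite mE.
  by rewrite hutchinson_preimage// /m' sumr_const card_ord mule_natl.
by rewrite ge0_integral_measure_sum// /m' sumr_const card_ord mule_natl.
Qed.

Lemma contraction_ratio : exists r : R, 0 < r < 1 /\
  forall i x y, mdist (sigma i x) (sigma i y) <= r * mdist x y.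
Proof.
have [r_ rP] := choice sigma_contr.
exists (\big[Num.max/2^-1]_(i < N) r_ i); split.
  apply/andP; split; first by apply: lt_le_trans (bigmax_ge_id _ _ _ _); lra.
  by apply: bigmax_lt => [|i _]; [lra|have [/andP[]] := rP i].
move=> i x y; apply: le_trans ((rP i).2 x y) _.
by rewrite ler_wpM2r ?mdist_ge0// le_bigmax.
Qed.

Let mX : measurable (X : set (borel Y)) := attractor_measurable X_attr.

Let mC : measurable (~` X : set (borel Y)). Proof. exact: measurableC. Qed.

(** Composition with the maps sigma_i multiplies the distance to X by at most
   r < 1, while by invariance the average of the integrals of the compositions
   is the integral itself; being finite, this integral vanishes. *)
Lemma hutchinson_support : mu (~` X : set (borel Y)) = 0%E.
Proof.
have [X0 cX _] := X_attr.
have clX : closed X by exact: compact_closed (@metric_hausdorff R Y) cX.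
have [r [/andP[r0 r1] rP]] := contraction_ratio.
pose dX (y : borel Y) := (dist_to X y)%:E.
have mdX : measurable_fun setT dX.
  by apply/measurable_EFinP; apply: lipschitz1_measurable => // x y _ _; exact: dist_to_lipschitz.
have dX0 y : (0 <= dX y)%E by rewrite lee_fin dist_to_ge0.
have dXs i y : dist_to X (sigma i y) <= r * dist_to X y.
  rewrite -ler_pdivrMl//; apply: le_dist_to => // x Xx.
  rewrite ler_pdivrMl//; apply: le_trans (rP i y x).
  exact/dist_to_le/attractor_sub.
have iX : mu.-integrable setT dX.
  by apply: mu_hutch.1; exists 1 => x y; rewrite mul1r dist_to_lipschitz.
have fX := integrable_fin_num measurableT iX.
have := hutchinson_integral mdX dX0.
set t := (\int[mu]_x dX x)%E => tE.
have t0 : t = 0%E.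
  have h : (N%:R%:E * t <= N%:R%:E * (r%:E * t))%E.
    have <- : (\sum_(i < N) r%:E * t = N%:R%:E * (r%:E * t))%E.
      by rewrite sumr_const card_ord mule_natl.
    rewrite -tE.
    apply: lee_sum => i _; rewrite -ge0_integralZl_EFin//; last exact: ltW.
    apply: ge0_le_integral => //.
    - exact: measurableT_comp mdX (msigma i).
    - by apply: measurable_funeM.
    - by move=> y _; rewrite -EFinM lee_fin.
  have t0 : (0 <= t)%E by exact: integral_ge0.
  have tE' : t = (fine t)%:E by rewrite fineK.
  move: h t0; rewrite {}tE' -!EFinM !lee_fin => h t0; congr EFin.
  apply/eqP; rewrite eq_le t0 andbT; move: h; rewrite ler_pM2l ?ltr0n//.
  by move: (fine t) => v; nra.
have /(ae_eq_integral_abs mu measurableT mdX) : (\int[mu]_x `|dX x| = 0)%E.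
  by under eq_integral do rewrite gee0_abs//.
move=> [E [mE E0 subE]]; apply: (subset_measure0 mC mE _ E0).
move=> y Xy; apply: subE => /= /(_ I)[dy0]; apply: Xy.
exact: (dist_to_eq0 X0 clX dy0).
Qed.

Local Notation XB := (X : set (borel Y)).

Lemma integral_attractor (g : borel Y -> \bar R) : measurable_fun setT g ->
  (forall x, 0 <= g x)%E -> (\int[mu]_x g x = \int[mu]_(x in XB) g x)%E.
Proof.
move=> mg g0; rewrite (ge0_negligible_integral mC)//; last exact: hutchinson_support.
by rewrite setDE setTI setCK.
Qed.

(** Restricting the integrals to X changes nothing since mu is carried by X and
   each sigma_i maps X to itself. *)
Lemma hutchinson_integral_attractor (g : borel Y -> \bar R) : measurable_fun XB g ->
  (forall x, X x -> 0 <= g x)%E ->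
  (\sum_(i < N) \int[mu]_(x in XB) g (sigma i x) =
   N%:R%:E * \int[mu]_(x in XB) g x)%E.
Proof.
move=> mg g0.
have mg' : measurable_fun setT (g \_ XB) by exact: (measurable_restrictT _ mX).1.
have g'0 x : (0 <= (g \_ XB) x)%E by apply: erestrict_ge0.
rewrite integral_mkcond -(hutchinson_integral mg' g'0); apply: eq_bigr => i _.
rewrite [RHS]integral_attractor//; last first.
  exact: measurableT_comp mg' (msigma i).
by apply: eq_integral => x /set_mem Xx; rewrite patchE mem_set//; exact: attractor_sub.
Qed.

(** By invariance, mu (sigma_i^-1 E) <= N mu E. This is what makes the class of
   phi o sigma_i depend only on the class of phi. *)
Lemma ae_attractor_comp (P : Y -> Prop) i :
  {ae mu, forall x, X x -> P x} -> {ae mu, forall x, X x -> P (sigma i x)}.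
Proof.
move=> [E [mE E0 subE]].
have msE j : measurable (sigma j @^-1` E : set (borel Y)).
  by rewrite -[X in measurable X]setTI; exact: msigma.
exists (sigma i @^-1` E); split => //.
  apply/eqP; rewrite eq_le measure_ge0 andbT -(mule0 N%:R%:E) -E0.
  rewrite -hutchinson_preimage// (bigD1 i)//= leeDl//.
  by apply: sume_ge0 => j _; exact: measure_ge0.
by move=> x /= nP; apply: subE => /= sP; apply: nP => Xx; apply: sP; exact: attractor_sub.
Qed.

End Hutchinson.

(** * The composition operators *)

Section Polarization.
Context (R : realType) (H : lmodType R[i]) (ip : {dot H for Num.conj}).
Local Open Scope complex_scope.

(** Expanding the squared norms at g + h gives the real parts; the imaginary
   parts follow on replacing h by i h. *)
Lemma isometry_polarization (J : finType) (F : J -> H -> H) :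
  (forall i, linear (F i)) ->
  (forall h, \sum_i rdot ip (F i h) (F i h) = rdot ip h h) ->
  forall g h, \sum_i ip (F i g) (F i h) = ip g h.
Proof.
move=> lF sF.
have FD i u v : F i (u + v) = F i u + F i v by rewrite -[u]scale1r lF !scale1r.
have FZ i c u : F i (c *: u) = c *: F i u by exact: (scalable_linear (lF i)).
have re g h : \sum_i rdot ip (F i g) (F i h) = rdot ip g h.
  have := sF (g + h); rewrite rdotDl !rdotDr (rdotC _ h g).
  under eq_bigr do rewrite FD rdotDl !rdotDr (rdotC _ (F _ h) (F _ g)).
  by rewrite !big_split /= !sF; lra.
move=> g h; rewrite [RHS]ipE -!re; apply/eqP; rewrite eq_complex /=.
rewrite (big_morph (@complex.Re R) (@Defs.ReD R) (erefl : complex.Re 0 = 0)).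
rewrite (big_morph (@complex.Im R) (@Defs.ImD R) (erefl : complex.Im 0 = 0)).
apply/andP; split; apply/eqP; apply: eq_bigr => i _ //.
by rewrite FZ Im_ip.
Qed.

End Polarization.

Section CompositionOperators.
Context (R : realType) (Y : completeMetricType R) (N : nat).
Variable sigma : 'I_N -> Y -> Y.
Hypothesis N2 : (2 <= N)%N.
Hypothesis sigma_contr : forall i, lipschitz_contraction (@mdist R Y) (sigma i).
Variables (X : set Y) (X_attr : attractor sigma X).
Variables (mu : probability (borel Y) R) (mu_hutch : hutchinson_measure sigma mu).
Local Open Scope complex_scope.

Let mX : measurable (X : set (borel Y)) := attractor_measurable X_attr.
Local Notation XB := (X : set (borel Y)).
Local Notation ip := (@L2dot _ _ R mu XB mX).
Local Notation F i := (scaled_comp (mu := mu) (mD := mX) N (sigma i : borel Y -> borel Y)).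

Lemma measurable_fun_attractor i :
  measurable_fun XB (sigma i : borel Y -> borel Y).
Proof. by apply: measurable_funTS; exact: contraction_measurable. Qed.

Lemma measurable_comp_attractor (g : borel Y -> R) i :
  measurable_fun XB g -> measurable_fun XB (g \o (sigma i : borel Y -> borel Y)).
Proof.
move=> mg; apply: (measurable_comp mX) mg (measurable_fun_attractor i).
by move=> _ [x Xx <-]; exact: (attractor_sub X_attr).
Qed.

Lemma hutchinson_sqmodulus (f : L2fun mu mX) :
  (\sum_(i < N) \int[mu]_(x in XB) (sqmodulus (f (sigma i x)))%:E =
   N%:R%:E * \int[mu]_(x in XB) (sqmodulus (f x))%:E)%E.
Proof.
apply: (hutchinson_integral_attractor N2 sigma_contr X_attr mu_hutch
  (g := fun x => (sqmodulus (f x))%:E)).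
  by have [mr mi _] := L2funP f; exact: measurable_Esqmodulus.
by move=> x _; rewrite lee_fin sqmodulus_ge0.
Qed.

Lemma square_integrable_comp (f : L2fun mu mX) i :
  square_integrable mu XB (f \o (sigma i : borel Y -> borel Y)).
Proof.
have [mr mi iF] := L2funP f.
have mr' := measurable_comp_attractor i mr; have mi' := measurable_comp_attractor i mi.
split => //; apply/integrableP; split; first exact: measurable_Esqmodulus.
under eq_integral do rewrite gee0_abs ?lee_fin ?sqmodulus_ge0//.
apply: (@le_lt_trans _ _ (N%:R%:E * \int[mu]_(x in XB) (sqmodulus (f x))%:E)%E).
  rewrite -hutchinson_sqmodulus (bigD1 i)//= leeDl//.
  apply: sume_ge0 => j _; apply: integral_ge0 => x _.
  by rewrite lee_fin sqmodulus_ge0.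
by rewrite -(fineK (integrable_fin_num mX iF)) -EFinM ltry.
Qed.

Definition L2comp i (f : L2fun mu mX) : L2fun mu mX :=
  MkL2fun (asboolT (square_integrable_comp f i)).

Lemma scaled_comp_pi i (f : L2fun mu mX) :
  F i (L2pi f) = ((Num.sqrt N%:R)^-1)%:C *: L2pi (L2comp i f).
Proof.
rewrite /scaled_comp /L2class; congr (_ *: _); apply/L2piP.
have val_in : (L2repr (L2pi f) \o sigma i) \in L2pred mu mX.
  by rewrite inE; exact: square_integrable_comp.
have -> : insubd (0 : L2fun mu mX) (L2repr (L2pi f) \o sigma i) =
    L2comp i (L2repr (L2pi f)).
  by apply: val_inj; rewrite /= insubdK.
exact: (ae_attractor_comp N2 sigma_contr X_attr mu_hutch i (L2repr_pi f)).
Qed.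

Lemma scaled_comp_linear i : linear (F i).
Proof.
move=> c u v; rewrite -[u]L2reprK -[v]L2reprK -L2piP_lin !scaled_comp_pi.
rewrite scalerA mulrC -scalerA -scalerDr -L2piP_lin; congr (_ *: L2pi _).
exact: val_inj.
Qed.

Lemma sum_hnorm_scaled_comp u :
  \sum_(i < N) rdot ip (F i u) (F i u) = rdot ip u u.
Proof.
rewrite -[u]L2reprK; set f := L2repr u.
have Npos : 0 < (N%:R : R) by rewrite ltr0n; exact: ltn_trans N2.
have FE i : rdot ip (F i (L2pi f)) (F i (L2pi f)) =
    N%:R^-1 * hnorm ip (L2pi (L2comp i f)) ^+ 2.
  rewrite scaled_comp_pi rdotZl rdotZr mulrA -invfM -expr2 sqr_sqrtr ?ltW//.
  by rewrite hnorm_sq.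
under eq_bigr do rewrite FE.
rewrite -mulr_sumr -hnorm_sq; apply: (mulfI (lt0r_neq0 Npos)).
rewrite mulrA divff ?lt0r_neq0// mul1r; apply: EFin_inj.
rewrite -sumEFin EFinM hnorm_L2pi -hutchinson_sqmodulus.
by apply: eq_bigr => i _; rewrite hnorm_L2pi.
Qed.

Lemma scaled_comp_bounded i : bounded_op ip (F i).
Proof.
split; first exact: scaled_comp_linear.
exists 1 => u; rewrite mul1r -(@ler_pXn2r _ 2)// ?nnegrE ?hnorm_ge0//.
rewrite !hnorm_sq -[leRHS]sum_hnorm_scaled_comp (bigD1 i)//= lerDl.
by apply: sumr_ge0 => j _; exact: rdot_ge0.
Qed.

Lemma sum_ip_scaled_comp g h : \sum_(i < N) ip (F i g) (F i h) = ip g h.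
Proof. exact: isometry_polarization scaled_comp_linear sum_hnorm_scaled_comp g h. Qed.

End CompositionOperators.

(** * The generalized Kantorovich metric *)

Section OperatorNorm.
Context (R : realType) (H : lmodType R[i]) (ip : {dot H for Num.conj}).
Implicit Types (L : H -> H).
Local Open Scope complex_scope.
Local Notation nrm := (hnorm ip).

Lemma opnorm_ub L : bounded_op ip L ->
  has_ubound [set nrm (L h) | h in [set h | nrm h <= 1]].
Proof.
move=> [_ [M LM]]; exists `|M| => _ [h /= h1 <-]; apply: le_trans (LM h) _.
apply: le_trans (_ : `|M| * nrm h <= _); first by rewrite ler_wpM2r ?hnorm_ge0 ?ler_norm.
by rewrite ler_piMr.
Qed.

Lemma opnorm_ge0 L : bounded_op ip L -> 0 <= opnorm ip L.
Proof.
move=> bL; apply: le_trans (hnorm_ge0 ip (L 0)) _.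
by apply: (ub_le_sup (opnorm_ub bL)); exists 0; rewrite //= hnorm0.
Qed.

Lemma hnorm_le_opnorm L h : bounded_op ip L -> nrm (L h) <= opnorm ip L * nrm h.
Proof.
move=> bL; have [lL [M LM]] := bL.
have [h0|h0] := eqVneq (nrm h) 0.
  by rewrite h0 mulr0; have := LM h; rewrite h0 mulr0.
have hp : 0 < nrm h by rewrite lt_def h0 hnorm_ge0.
have nrmV u : nrm ((nrm h)^-1%:C *: u) = (nrm h)^-1 * nrm u.
  by rewrite hnormZ ger0_norm// invr_ge0 ltW.
rewrite -ler_pdivrMr// mulrC -nrmV -(scalable_linear lL).
apply: (ub_le_sup (opnorm_ub bL)); exists ((nrm h)^-1%:C *: h) => //=.
by rewrite nrmV mulVf.
Qed.

Lemma opnorm_le L c : 0 <= c -> (forall h, nrm (L h) <= c * nrm h) -> opnorm ip L <= c.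
Proof.
move=> c0 Lc; apply: ge_sup; first by exists (nrm (L 0)), 0; rewrite //= hnorm0.
by move=> _ [h /= h1 <-]; apply: le_trans (Lc h) _; rewrite ler_piMr.
Qed.

Lemma bounded_opB L L' : bounded_op ip L -> bounded_op ip L' -> bounded_op ip (L - L').
Proof.
move=> bL [lL' [M LM]]; apply: bounded_opD => //; split.
  by move=> c g h; rewrite !fctE lL' opprD scalerN.
by exists M => h; rewrite !fctE hnorm_opp.
Qed.

End OperatorNorm.

Section Kantorovich.
Context (R : realType) (Y : completeMetricType R) (X : set Y).
Hypotheses (X0 : X !=set0) (cX : compact X).
Context (mX : measurable (X : set (borel Y))).
Context (H : lmodType R[i]) (ip : {dot H for Num.conj}).
Hypothesis cH : complete_dot ip.
Local Notation XB := (X : set (borel Y)).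
Local Notation nrm := (hnorm ip).
Local Open Scope complex_scope.
Implicit Types A B : povm XB ip.

Lemma compact_diameter x0 : exists K : R, forall x, X x -> mdist x0 x <= K.
Proof.
have cont : continuous (fun y : Y => mdist x0 y : R^o).
  move=> y; apply/cvgrPdist_lt => e e0.
  apply/metricType_numDomainType.nbhs_mdistP; exists e => //= z yz.
  apply: le_lt_trans yz; rewrite ler_norml; apply/andP; split.
    by rewrite lerNl opprB lerBlDl; exact: metric_triangle.
  by rewrite lerBlDl (metric_sym y z); exact: metric_triangle.
have := continuous_compact (continuous_subspaceT cont) cX.
move=> /compact_bounded[M [_ MX]]; exists (M + 1) => x Xx.
by have := MX (M + 1) (ltr_pwDr ltr01 (lexx M)) _ (ex_intro2 _ _ x Xx erefl); apply: le_trans; exact: ler_norm.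
Qed.

(** Adding a constant to f does not change the difference of the operator
   integrals of f, since all measures have total mass the identity; hence f may
   be assumed to be bounded by the diameter of X. *)
Lemma op_integral_diff_shift A B (f : Y -> R) M c : bounded_measurable XB f M ->
  op_integral mX A f - op_integral mX B f =
  op_integral mX A (fun x => f x - c) - op_integral mX B (fun x => f x - c).
Proof.
move=> bf; have bc := bounded_measurable_cst XB (- c).
have E (C : povm XB ip) : op_integral mX C (fun x => f x - c) =
    fun h => op_integral mX C f h + (- c)%:C *: h.
  have := op_integral_linear mX cH C 1 bf bc.
  rewrite (op_integral_cst mX cH) (_ : (fun x => _) = (fun x => f x - c)).
    by move=> ->; apply/funext => h; rewrite scale1r.
  by apply/funext => x; rewrite mul1r.
rewrite (E A) (E B); apply/funext => h.
by rewrite -[LHS]addr0 -(subrr ((- c)%:C *: h)) addrACA -opprD.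
Qed.

Lemma Lip1_measurable (f : Y -> R) : Lip1 X f -> measurable_fun XB (f : borel Y -> R).
Proof. by move=> f1; exact: lipschitz1_measurable. Qed.

Lemma Lip1_bounded (f : Y -> R) : Lip1 X f -> exists M, bounded_measurable XB f M.
Proof.
move=> f1; have [x0 Xx0] := X0; have [K XK] := compact_diameter x0.
exists (`|f x0| + K); split; first exact: Lip1_measurable.
move=> x Xx; rewrite -[f x](subrK (f x0)) addrC; apply: le_trans (ler_normD _ _) _.
by rewrite lerD2l (le_trans (f1 x x0 Xx Xx0))// metric_sym XK.
Qed.

Lemma bounded_op_integral_diff A B f M : bounded_measurable XB f M ->
  bounded_op ip (op_integral mX A f - op_integral mX B f).
Proof.
move=> bf; have [bA _ _] := op_integralP mX cH A bf.
by have [bB _ _] := op_integralP mX cH B bf; exact: bounded_opB.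
Qed.

(** Without this bound the real supremum defining the distance would carry no
   information. *)
Lemma kantorovich_ub A B :
  has_ubound [set opnorm ip (op_integral mX A f - op_integral mX B f) | f in Lip1 X].
Proof.
have [x0 Xx0] := X0; have [K XK] := compact_diameter x0.
have K0 : 0 <= K by apply: le_trans (XK _ Xx0); exact: mdist_ge0.
exists (K + K) => _ [f f1 <-].
have [M bf] := Lip1_bounded f1.
rewrite (op_integral_diff_shift A B (f x0) bf).
have bK : bounded_measurable XB (fun x => f x - f x0) K.
  split; first by apply: measurable_funB => //; exact: Lip1_measurable.
  by move=> x Xx; rewrite (le_trans (f1 x x0 Xx Xx0))// metric_sym XK.
apply: opnorm_le => [|h]; first exact: addr_ge0.
have [_ _ AK] := op_integralP mX cH A bK; have [_ _ BK] := op_integralP mX cH B bK.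
by rewrite !fctE; apply: le_trans (ler_hnormD _ _ _) _; rewrite hnorm_opp mulrDl lerD.
Qed.

Lemma opnorm_le_kantorovich A B f : Lip1 X f ->
  opnorm ip (op_integral mX A f - op_integral mX B f) <= kantorovich mX A B.
Proof. by move=> f1; apply: (ub_le_sup (kantorovich_ub A B)); exists f. Qed.

Lemma Lip1_0 : Lip1 X (cst 0 : Y -> R).
Proof. by move=> x y _ _; rewrite subrr normr0 mdist_ge0. Qed.

Lemma kantorovich_ge0 A B : 0 <= kantorovich mX A B.
Proof.
apply: le_trans (opnorm_le_kantorovich A B Lip1_0); apply: opnorm_ge0.
exact: bounded_op_integral_diff (bounded_measurable_cst XB 0).
Qed.

(** The function f / r is 1-Lipschitz on X. *)
Lemma lipschitz_op_integral_diff A B (f : Y -> R) (r : R) h : 0 < r ->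
  (forall x y, X x -> X y -> `|f x - f y| <= r * mdist x y) ->
  nrm ((op_integral mX A f - op_integral mX B f) h) <= r * kantorovich mX A B * nrm h.
Proof.
move=> r0 fr; pose g x := r^-1 * f x.
have g1 : Lip1 X g.
  move=> x y Xx Xy; rewrite /g -mulrBr normrM gtr0_norm ?invr_gt0//.
  by rewrite ler_pdivrMl// fr.
have [M bg] := Lip1_bounded g1.
have fE (C : povm XB ip) : op_integral mX C f = fun h => r%:C *: op_integral mX C g h.
  have := op_integral_linear mX cH C r bg (bounded_measurable_cst XB 0).
  rewrite (op_integral_cst mX cH) (_ : (fun x => _) = f).
    by move=> ->; apply/funext => k; rewrite scale0r addr0.
  by apply/funext => x; rewrite /g mulrA divff ?gt_eqF// mul1r addr0.
rewrite (fE A) (fE B) !fctE -scalerBr hnormZ gtr0_norm// -mulrA ler_pM2l//.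
have bD := bounded_op_integral_diff A B bg.
apply: le_trans (hnorm_le_opnorm h bD) _.
by rewrite ler_wpM2r ?hnorm_ge0//; exact: opnorm_le_kantorovich.
Qed.

Section Contraction.
Context (J : finType) (F S : J -> H -> H) (sigma : J -> Y -> Y) (r : R).
Hypothesis msigma : forall i, measurable_fun XB (sigma i : borel Y -> borel Y).
Hypothesis Xsigma : forall i x, X x -> X (sigma i x).
Hypothesis bF : forall i, bounded_op ip (F i).
Hypothesis bS : forall i, bounded_op ip (S i).
Hypothesis FS : forall i g h, ip (F i g) h = ip g (S i h).
Hypothesis sumF : forall g h, \sum_i ip (F i g) (F i h) = ip g h.
Hypothesis r0 : 0 < r.
Hypothesis sigma_r : forall i x y, mdist (sigma i x) (sigma i y) <= r * mdist x y.

Local Notation V := (transport (D := XB) (ip := ip)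
  (tau := fun i => sigma i : borel Y -> borel Y) mX msigma Xsigma bF bS FS sumF).

(** The blocks to which hnorm_transport_le applies are the differences of the
   integrals of the r-Lipschitz functions f o sigma_i. *)
Lemma kantorovich_transport A B :
  kantorovich mX (V A) (V B) <= r * kantorovich mX A B.
Proof.
have rk0 : 0 <= r * kantorovich mX A B by rewrite mulr_ge0 ?kantorovich_ge0// ltW.
apply: ge_sup; first by exists (opnorm ip (op_integral mX (V A) (cst 0) -
  op_integral mX (V B) (cst 0))), (cst 0) => //; exact: Lip1_0.
move=> _ [f f1 <-]; apply: opnorm_le => // h.
have [M bf] := Lip1_bounded f1.
have -> : op_integral mX (V A) f - op_integral mX (V B) f =
    \sum_i (S i \o (op_integral mX A (f \o sigma i) - op_integral mX B (f \o sigma i)) \o F i).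
  rewrite !(op_integral_transport mX msigma Xsigma bF bS FS sumF cH _ bf).
  rewrite -sumrB; apply: eq_bigr => i _; apply/funext => k.
  have SB u v : S i (u - v) = S i u - S i v.
    by have [lS _] := bS i; rewrite -scaleN1r addrC lS scaleN1r addrC.
  exact/esym/SB.
apply: (hnorm_transport_le bF FS sumF) => // i u.
apply: lipschitz_op_integral_diff => // x y Xx Xy.
by apply: le_trans (f1 _ _ (Xsigma i Xx) (Xsigma i Xy)) _.
Qed.

End Contraction.

End Kantorovich.

Theorem theorem2p22 (R : realType) (Y : completeMetricType R)
    (Ysep : separable Y) (N : nat) (N2 : (2 <= N)%N)
    (sigma : 'I_N -> Y -> Y)
    (sigma_contr : forall i, lipschitz_contraction (@mdist R Y) (sigma i))
    (X : set Y) (X_attr : attractor sigma X)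
    (mu : probability (borel Y) R) (mu_hutch : hutchinson_measure sigma mu) :
  let mX := attractor_measurable X_attr in
  let H : lmodType R[i] := L2 mu mX in
  let ip : {dot H for Num.conj} := @L2dot _ _ R mu X mX in
  let F (i : 'I_N) : H -> H :=
    scaled_comp (mu := mu) (mD := mX) N (sigma i : borel Y -> borel Y) in
  let S (i : 'I_N) : H -> H := adjoint ip (F i) in
  exists V : povm (X : set (borel Y)) ip -> povm (X : set (borel Y)) ip,
    (forall (B : povm (X : set (borel Y)) ip) (E : set (borel Y)),
       measurable E -> E `<=` X ->
       V B E = \sum_(i < N)
         (S i \o B (X `&` sigma i @^-1` E) \o adjoint ip (S i))) /\
    lipschitz_contraction (kantorovich mX (ip := ip)) V.
Proof.
move=> mX H ip F S.
have [X0 cX _] := X_attr.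
have cH : complete_dot ip by exact: L2_complete.
have bF i : bounded_op ip (F i).
  exact: (scaled_comp_bounded N2 sigma_contr X_attr mu_hutch).
have bS i : bounded_op ip (S i) by have [] := adjointP cH (bF i).
have FS i g h : ip (F i g) h = ip g (S i h) by have [_] := adjointP cH (bF i).
have SF i : adjoint ip (S i) = F i.
  by apply: adjoint_unique => // g h; rewrite ip_conj -FS -ip_conj.
have sumF g h : \sum_i ip (F i g) (F i h) = ip g h.
  exact (sum_ip_scaled_comp N2 sigma_contr mu_hutch g h).
have msigma i := measurable_fun_attractor sigma_contr (X := X) i.
have Xsigma i x : X x -> X (sigma i x) by exact: (attractor_sub X_attr).
have [r [/andP[r0 r1] rP]] := contraction_ratio sigma_contr.
exists (transport mX msigma Xsigma bF bS FS sumF); split.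
  move=> B E mE EX; under [RHS]eq_bigr do rewrite SF.
  by [].
exists r; split; first by rewrite r0.
by move=> A B; exact: kantorovich_transport.
Qed.
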